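(* There are universal constants $C,C'>0$ such that the following holds for reward-free learning in CMDPs. Let $\mathcal M$ be a finite class of zero-reward models with $M_\star\in\mathcal M$, let $\varepsilon>0$ and $\delta\in(0,1/2)$. Then for some number of rounds $$T\le C\,\frac{H^7S^4A^3\log(|\mathcal M|/\delta)}{\varepsilon^2},$$ the algorithm LOLIPOP (defined in the context), run for $T$ rounds with $N=2$ epochs, $\tau_1=T/(2H)$, $\tau_2=T/H$, and oracle $\mathsf{MLE}_{\mathcal M}$, produces a model $\widehat M_2$ such that, with probability at least $1-\delta$, for every reward distribution $R=\{R^h\}_{h\in[H]}$ and every family of policies $\{\pi_c\}_{c\in\mathcal C}$, $$\mathbb E_{c\sim\mathcal D}\Big[\big|V^1_\star(\pi_c,c,R)-V^1_{\widehat M_2}(\pi_c,c,R)\big|\Big]\le\varepsilon.$$ Moreover, the algorithm makes at most $C'H$ calls to $\mathsf{MLE}_{\mathcal M}$.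
   Context: **Setting.** A contextual MDP (CMDP) of horizon $H$ has a context space $\mathcal C$, finite state and action spaces $\mathcal S,\mathcal A$ with $S=|\mathcal S|$, $A=|\mathcal A|$, a fixed initial state $s^1\in\mathcal S$, and a model $M=\{P_M^h,R_M^h\}_{h\in[H]}$ with transition kernels $P_M^h(\cdot\mid s,a;c)\in\Delta(\mathcal S)$ and reward distributions $R_M^h(s,a;c)\in\Delta([0,1])$. $\Pi_{\mathrm{RNS}}$ is the set of policies $\pi=(\pi^1,\dots,\pi^H)$, $\pi^h:\mathcal S\to\Delta(\mathcal A)$; $\pi^h(s,a)$ is the probability of $a$ at $s$. For a model $M$, policy $\pi$, context $c$, $M(\pi,c)$ is the law of the trajectory $(s_1^1,a_1^1,r_1^1,\dots,s_1^H,a_1^H,r_1^H)$ with $s_1^1=s^1$, $a_1^h\sim\pi^h(s_1^h)$, $r_1^h\sim R_M^h(s_1^h,a_1^h;c)$, $s_1^{h+1}\sim P_M^h(\cdot\mid s_1^h,a_1^h;c)$. The true model is $M_\star$. In each round $t=1,\dots,T$: $c_t\sim\mathcal D$ i.i.d. (with $\mathcal D$ unknown), the learner sees $c_t$, chooses $\pi_t\in\Pi_{\mathrm{RNS}}$ and observes a trajectory drawn from $M_\star(\pi_t,c_t)$. **Reward-free setting.** All models in $\mathcal M$ (in particular $M_\star\in\mathcal M$) have reward identically $0$. For a model $M$ and a reward distribution $R=\{R^h\}_{h\in[H]}$, $R^h(s,a;c)\in\Delta([0,1])$, for which the total reward of a trajectory lies in $[0,1]$ almost surely, $V_M^1(\pi,c,R)$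 is the expected total reward of policy $\pi$ under context $c$ in the model $\{P_M^h,R^h\}_{h\in[H]}$, and $V_\star^1=V_{M_\star}^1$. **Offline oracle.** $D_{\mathrm H}^2(\mathbb P,\mathbb Q)=\frac12\int(\sqrt{d\mathbb P/d\nu}-\sqrt{d\mathbb Q/d\nu})^2d\nu$ ($\nu$ any common dominating measure) is the squared Hellinger distance. An offline density estimation oracle for $\mathcal M$ with error function $\mathcal E_{\mathcal M,\delta}(n)$ takes $n$ i.i.d. samples $(c_i,\pi_i,\text{trajectory}_i)$, with $c_i\sim\mathcal D$, $\pi_i\sim p(c_i)$ for a kernel $p:\mathcal C\to\Delta(\Pi_{\mathrm{RNS}})$, and trajectory drawn from $M_\star(\pi_i,c_i)$, and returns a model $\widehat M$ such that, for any $\delta\in(0,1/2)$, with probability at least $1-\delta$, $\mathbb E_{c\sim\mathcal D,\pi\sim p(c)}[D_{\mathrm H}^2(\widehat M(\pi,c),M_\star(\pi,c))]\le\mathcal E_{\mathcal M,\delta}(n)$. $\mathsf{MLE}_{\mathcal M}$ returns a maximizer over $M\in\mathcal M$ of the likelihood of the observed trajectories given $(c_i,\pi_i)$; for finite $\mathcal M$ it is an oracle with $\mathcal E_{\mathcal M,\delta}(n)=C_0\log(|\mathcal M|/\delta)/n$ ($n\ge1$) for a universal constant $C_0$. **Algorithm LOLIPOP.** Input: schedule $0=\tau_{-1}=\tau_0<\tau_1<\dots<\tau_N=T/H$, $\delta\in(0,1/2)$, $\mathcal M$, an oracle (integer rounding is ignored). Epoch $m$ consists of segments $h=1,\dots,H$;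 segment $h$ consists of the rounds $\tau_{m-1}H+(\tau_m-\tau_{m-1})(h-1)<t\le\tau_{m-1}H+(\tau_m-\tau_{m-1})h$. Initially $\widehat M_0=\{\widehat P_0^h,\widehat R_0^h\}_h$ with arbitrary kernels and zero rewards. In epoch $m$ set $$\mathcal E_m=\mathcal E_{\mathcal M,\delta/(2N^2)}(\tau_{m-1}-\tau_{m-2}),\quad \gamma_m=\sqrt{H^6S^4A^3/\mathcal E_m},\quad \eta_m=\frac{\gamma_m}{720e^3H^5S^3A^2},\quad \zeta_m=\frac{\gamma_m}{8eH(H+1)^2}.$$ (For $m=1$ the argument of the error function is $0$; $\mathcal E_1$ is left unspecified and may be any positive number. It affects only the policies played in epoch 1, and $\widehat M_2$ depends on epoch 1 only through $\widehat{\mathrm{reg}}_1$, which is $0$ here because all rewards are $0$.) Let $\widehat V^1_{m-1}(\pi,c)$ be the value (expected total reward) of $\pi$ under context $c$ in the model $\widehat M_{m-1}$, $\widehat\pi_{m-1,c}\in\arg\max_\pi\widehat V^1_{m-1}(\pi,c)$, and $\widehat{\mathrm{reg}}_{m-1}(\pi,c)=\max_{\pi'}\widehat V^1_{m-1}(\pi',c)-\widehat V^1_{m-1}(\pi,c)$. Trusted occupancy measures $\widetilde d$ and trusted transitions $\widetilde{\mathcal T}$ are defined recursively in $h$: $\widetilde d_m^1(s;\pi,c)=\mathbb 1(s=s^1)$; for $h\ge2$, $\widetilde d_m^h(s;\pi,c)=\sum_{(s',a'):(s',a',s)\in\widetilde{\mathcal T}_m^{h-1}(c)}\widetilde d_m^{h-1}(s',a';\pi,c)\widehat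 P_m^{h-1}(s\mid s',a';c)$; $\widetilde d_m^h(s,a;\pi,c)=\widetilde d_m^h(s;\pi,c)\pi^h(s,a)$; and $$\widetilde{\mathcal T}_m^h(c)=\Big\{(s,a,s'):\max_\pi\frac{\widetilde d_m^h(s,a;\pi,c)}{SA+\eta_m\widehat{\mathrm{reg}}_{m-1}(\pi,c)}\,\widehat P_m^h(s'\mid s,a;c)\ge\frac1{\zeta_m}\Big\}.$$ In segment $h$ of epoch $m$, upon observing $c_t=c$: for each $(s,a)$ let $\pi_{m,c}^{h,s,a}\in\arg\max_\pi\frac{\widetilde d_m^h(s,a;\pi,c)}{SA+\eta_m\widehat{\mathrm{reg}}_{m-1}(\pi,c)}$; let $\Pi_m^h(c)=\{\widehat\pi_{m-1,c}\}\cup\{\pi_{m,c}^{h,s,a}\}_{s,a}$; let $p_m^h(c)$ be the distribution on $\Pi_m^h(c)$ with $p_m^h(c,\pi)=1/(\lambda_{m,c}^h+\eta_m\widehat{\mathrm{reg}}_{m-1}(\pi,c))$, where $\lambda_{m,c}^h$ is the normalizing constant; sample and execute $\pi_t\sim p_m^h(c)$. At the end of segment $h$, call the oracle on the data $(c_t,\pi_t,\text{trajectory}_t)$ of this segment, and let $\widehat P_m^h,\widehat R_m^h$ be the layer-$h$ part of its output. At the end of the epoch set $\widehat M_m=\{\widehat P_m^h,\widehat R_m^h\}_{h\in[H]}$.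
   Formalization: The bound on T is read as T ≤ max(2H, C H^7 S^4 A^3 log(|M|/δ)/ε²): the schedule needs at least 2H rounds (one per segment), so for very large ε the literal bound admits no run; for ε ≤ 1 the literal bound follows after enlarging C. *)

(* Defs.v *)
From HB Require Import structures.
From mathcomp Require Import all_boot all_order all_algebra.
From mathcomp Require Import all_classical all_reals all_analysis.
From mathcomp Require Import measurable_realfun.
Set Implicit Arguments.
Unset Strict Implicit.
Unset Printing Implicit Defensive.
Import Order.TTheory GRing.Theory Num.Theory.
Local Open Scope classical_set_scope.
Local Open Scope ring_scope.

(* - Layers are numbered 0, ..., H - 1 (instead of 1, ..., H).  Families indexed
     by layers are functions of h : nat; their values at h >= H are never used.
   - A trajectory is recorded as the H-tuple of its state-action pairs.  The
     learner only interacts with a model whose rewards are identically 0, so the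
     observed rewards are the constant 0 and are not recorded.
   - The integral of the library is a total function, equal to the lower
     integral on nonnegative functions that are not measurable.  Hence no
     measurability is required of the oracle, nor of the reward distributions
     and policy families against which the final model is tested. *)

Section CMDP.
Variables (R : realType) (H : nat) (S A : finType).
Variables (d : measure_display) (ctx : measurableType d).

Definition is_policy (pi : H.-tuple {ffun S -> {ffun A -> R}}) : bool :=
  [forall h : 'I_H, forall s : S,
     [forall a : A, 0 <= tnth pi h s a] && (\sum_(a : A) tnth pi h s a == 1)].

Definition policy := {u : H.-tuple {ffun S -> {ffun A -> R}} | is_policy u}.

Definition pol (pi : policy) (h : nat) (s : S) (a : A) : R :=
  (nth 0 (val pi) h) s a.

Record reward := Reward {
  rlaw :> nat -> S -> A -> ctx -> probability (measurableTypeR R) R;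
  rlaw01 : forall h s a c, rlaw h s a c [set` `[0, 1]%R] = 1%E }.

Record model := Model {
  trans : nat -> S -> A -> ctx -> S -> R;
  rew : reward;
  trans_ge0 : forall h s a c s', 0 <= trans h s a c s';
  trans_sum1 : forall h s a c, \sum_(s' : S) trans h s a c s' = 1;
  trans_meas : forall h s a s',
    measurable_fun [set: ctx] (fun c => trans h s a c s');
  rew_meas : forall h s a (B : set (measurableTypeR R)), measurable B ->
    measurable_fun [set: ctx] (fun c => rew h s a c B : \bar R) }.

Definition zero_reward (M : model) : Prop :=
  forall (h : nat) (s : S) (a : A) (c : ctx),
    (h < H)%N -> rew M h s a c [set 0] = 1%E.

Definition traj := H.-tuple (S * A).

Variable s1 : S.

(* Probability of the state-action sequence x from layer h on, when the law of
   the state at layer h is mu. *)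
Fixpoint path_prob (M : model) (pi : policy) (c : ctx) (h : nat) (mu : S -> R)
    (x : seq (S * A)) : R :=
  if x is (s, a) :: x' then
    mu s * pol pi h s a * path_prob M pi c h.+1 (trans M h s a c) x'
  else 1.

Definition traj_prob (M : model) (pi : policy) (c : ctx) (x : traj) : R :=
  path_prob M pi c 0 (fun s => (s == s1)%:R) x.

(* Expectation of f (y + r_1 + ... + r_k) for independent r_i of law mu_i. *)
Fixpoint sum_expect (mus : seq (probability (measurableTypeR R) R))
    (f : R -> \bar R) (y : R) : \bar R :=
  if mus is mu :: mus' then (\int[mu]_r sum_expect mus' f (y + r))%E else f y.

(* Expectation of f (total reward) for a trajectory of the policy pi under the
   context c in the model with the transitions of M and the rewards Rw. *)
Definition total_expect (M : model) (Rw : reward) (pi : policy) (c : ctx)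
    (f : R -> \bar R) : \bar R :=
  (\sum_(x : traj) (traj_prob M pi c x)%:E *
     sum_expect [seq Rw h (tnth x h).1 (tnth x h).2 c | h : 'I_H] f 0)%E.

Definition value (M : model) (Rw : reward) (pi : policy) (c : ctx) : R :=
  fine (total_expect M Rw pi c EFin).

(* The total reward of a trajectory of the model with the transitions of M and
   the rewards Rw lies in [0, 1] almost surely, whatever the policy and the
   context. *)
Definition normalized (M : model) (Rw : reward) : Prop :=
  forall (pi : policy) (c : ctx),
    total_expect M Rw pi c (fun y => (\1_([set` `[0, 1]%R] : set R) y)%:E) = 1%E.

Definition datum := (ctx * policy * traj)%type.

Definition likelihood (M : model) (xs : seq datum) : R :=
  \prod_(x <- xs) traj_prob M x.1.2 x.1.1 x.2.

Definition is_MLE (I : finType) (Mcls : I -> model)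
    (oracle : seq datum -> model) : Prop :=
  forall xs : seq datum, exists i : I, oracle xs = Mcls i /\
    forall j : I, likelihood (Mcls j) xs <= likelihood (Mcls i) xs.

Definition MLE_err (I : finType) (C0 : R) (delta : R) (n : nat) : R :=
  C0 * ln (#|I|%:R / delta) / n%:R.

(* Inputs of the algorithm, and the choices which it leaves open:
   - tau m is tau_m for m >= 0 (tau_{-1} = 0 is not represented);
   - lo_E1 is the unspecified value of E_1, and lo_M0 is the model M_0;
   - lo_greedy M c is the maximizer pi_{m-1,c} of the value in M = M_{m-1};
   - lo_explore m M outs s a c is pi_{m,c}^{h,s,a}, where M = M_{m-1} and outs
     lists the h outputs of the oracle on the previous segments of epoch m. *)
Record inputs := Inputs {
  lo_N : nat;
  lo_tau : nat -> nat;
  lo_delta : R;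
  lo_err : R -> nat -> R;
  lo_oracle : seq datum -> model;
  lo_E1 : R;
  lo_M0 : model;
  lo_greedy : model -> ctx -> policy;
  lo_explore : nat -> model -> seq model -> S -> A -> ctx -> policy }.

Section Lolipop.
Variable alg : inputs.

Definition err_m (m : nat) : R :=
  if m == 1%N then lo_E1 alg
  else lo_err alg (lo_delta alg / (2 * (lo_N alg)%:R ^+ 2))
         (lo_tau alg m.-1 - lo_tau alg m.-2).

Definition gamma_m (m : nat) : R :=
  Num.sqrt (H%:R ^+ 6 * #|S|%:R ^+ 4 * #|A|%:R ^+ 3 / err_m m).

Definition eta_m (m : nat) : R :=
  gamma_m m /
    (720 * expR 1 ^+ 3 * H%:R ^+ 5 * #|S|%:R ^+ 3 * #|A|%:R ^+ 2).

Definition zeta_m (m : nat) : R :=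
  gamma_m m / (8 * expR 1 * H%:R * (H%:R + 1) ^+ 2).

(* The model whose layer h is that of the h-th model of outs. *)
Definition assemble (M : model) (outs : seq model) : model :=
  @Model (fun h s a c s' => trans (nth M outs h) h s a c s')
    (@Reward (fun h s a c => rew (nth M outs h) h s a c)
       (fun h s a c => rlaw01 (rew (nth M outs h)) h s a c))
    (fun h s a c s' => trans_ge0 (nth M outs h) h s a c s')
    (fun h s a c => trans_sum1 (nth M outs h) h s a c)
    (fun h s a s' => trans_meas (nth M outs h) h s a s')
    (fun h s a => @rew_meas (nth M outs h) h s a).

Definition own_value (M : model) (pi : policy) (c : ctx) : R :=
  value M (rew M) pi c.

Definition reg (M : model) (pi : policy) (c : ctx) : R :=
  sup (range (fun pi' : policy => own_value M pi' c)) - own_value M pi c.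

Section Segment.
Variables (m : nat) (Mprev : model) (outs : seq model).

Let Phat := trans (assemble Mprev outs).

Definition penalty (pi : policy) (c : ctx) : R :=
  #|S|%:R * #|A|%:R + eta_m m * reg Mprev pi c.

(* dh is the trusted occupancy measure of the states at layer h *)
Definition trusted (dh : policy -> S -> R) (h : nat) (c : ctx)
    (s : S) (a : A) (s' : S) : bool :=
  (zeta_m m)^-1 <=
  sup (range (fun pi : policy =>
    dh pi s * pol pi h s a / penalty pi c * Phat h s a c s')).

Fixpoint docc (h : nat) (c : ctx) (pi : policy) (s : S) : R :=
  if h is k.+1 then
    \sum_(x : S * A | trusted (docc k c) k c x.1 x.2 s)
      docc k c pi x.1 * pol pi k x.1 x.2 * Phat k x.1 x.2 c s
  else (s == s1)%:R.

Definition score (h : nat) (c : ctx) (s : S) (a : A) (pi : policy) : R :=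
  docc h c pi s * pol pi h s a / penalty pi c.

(* The set Pi_m^h(c), as a list without repetition. *)
Definition candidates (c : ctx) : seq policy :=
  undup (lo_greedy alg Mprev c ::
    [seq lo_explore alg m Mprev outs x.1 x.2 c | x : S * A]).

(* The positive normalizing constant of play_prob: it exists and is unique, as
   the regret is nonnegative and vanishes at the greedy policy. *)
Definition lambda (c : ctx) : R :=
  xget 0 [set l : R | 0 < l /\
    \sum_(pi <- candidates c) (l + eta_m m * reg Mprev pi c)^-1 = 1].

Definition play_prob (c : ctx) (pi : policy) : R :=
  (lambda c + eta_m m * reg Mprev pi c)^-1.

End Segment.

Definition is_argmax (f : policy -> R) (pi : policy) : Prop :=
  forall pi', f pi' <= f pi.

Definition policy_measurable (p : ctx -> policy) : Prop :=
  forall (h : nat) (s : S) (a : A),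
    measurable_fun [set: ctx] (fun c => pol (p c) h s a).

Definition valid_choices : Prop :=
  [/\ 0 < lo_E1 alg,
      zero_reward (lo_M0 alg),
      (forall M, policy_measurable (lo_greedy alg M) /\
         forall c, is_argmax (own_value M ^~ c) (lo_greedy alg M c)) &
      (forall m M outs s a,
         policy_measurable (lo_explore alg m M outs s a) /\
         forall c, is_argmax (score m M outs (size outs) c s a)
                     (lo_explore alg m M outs s a c))].

(* The law of the interaction with Mstar is represented by its expectation
   operators, i.e. by iterated integrals. *)

Variables (D : probability ctx R) (Mstar : model).

Definition round_expect (m : nat) (Mprev : model) (outs : seq model)
    (f : datum -> \bar R) : \bar R :=
  (\int[D]_c \sum_(pi <- candidates m Mprev outs c) \sum_(x : traj)
     (play_prob m Mprev outs c pi * traj_prob Mstar pi c x)%:E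
       * f (c, pi, x))%E.

Fixpoint rounds_expect (m : nat) (Mprev : model) (outs : seq model) (n : nat)
    (f : seq datum -> \bar R) : \bar R :=
  if n is n'.+1 then
    round_expect m Mprev outs (fun x =>
      rounds_expect m Mprev outs n' (fun xs => f (x :: xs)))
  else f [::].

(* The following functions take a continuation f, whose last argument is the
   list of the data sets on which the oracle has been called so far. *)

(* The last k segments of epoch m. *)
Fixpoint segments_expect (m : nat) (Mprev : model) (k : nat)
    (outs : seq model) (calls : seq (seq datum))
    (f : model -> seq (seq datum) -> \bar R) : \bar R :=
  if k is k'.+1 then
    rounds_expect m Mprev outs (lo_tau alg m - lo_tau alg m.-1) (fun xs =>
      segments_expect m Mprev k' (rcons outs (lo_oracle alg xs))
        (rcons calls xs) f)
  else f (assemble Mprev outs) calls.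

(* The k epochs m, m + 1, ..., m + k - 1. *)
Fixpoint epochs_expect (k m : nat) (Mprev : model) (calls : seq (seq datum))
    (f : model -> seq (seq datum) -> \bar R) : \bar R :=
  if k is k'.+1 then
    segments_expect m Mprev H [::] calls (fun M calls' =>
      epochs_expect k' m.+1 M calls' f)
  else f Mprev calls.

(* Probability of an event on the final model M_N and the calls made. *)
Definition lolipop_prob (E : set (model * seq (seq datum))) : \bar R :=
  epochs_expect (lo_N alg) 1 (lo_M0 alg) [::]
    (fun M calls => (\1_E (M, calls))%:E).

End Lolipop.

Definition two_epochs (T : nat) (m : nat) : nat :=
  nth 0%N [:: 0; T %/ (2 * H); T %/ H]%N m.

End CMDP.

(* Main.v *)
Require Import Defs.
From mathcomp Require Import all_boot all_order all_algebra.
From mathcomp Require Import all_classical all_reals all_analysis.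
From mathcomp Require Import measurable_realfun.
From mathcomp Require Import ring lra zify.
Import Order.TTheory GRing.Theory Num.Theory.
Local Open Scope classical_set_scope.
Local Open Scope ring_scope.
Set Implicit Arguments.
Unset Strict Implicit.
Unset Printing Implicit Defensive.

(* Rewards vanish, so all regrets are 0, the algorithm plays uniformly on its
   candidates and the second epoch does not depend on the first one.

   Fix a context and let L_h be 1 minus the mean Bhattacharyya coefficient
   between the trajectory laws of the h-th output and of the true model under
   the policies played in segment h.  This controls the Hellinger distance
   between the layer-h kernels P^ and P* at (s, a), weighted by the true
   occupancy of the policy exploring (s, a).  If all L_h are at most
   1 / (256 H^2 zeta), then, layer by layer, P^ (1 - 1 / 2H) <= P* on trusted
   transitions, trusted occupancies are at most twice the true ones, and a
   hybrid argument along them bounds the total variation distance between the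
   trajectory laws by H^2 zeta \sum_h L_h + H S^3 A^2 / zeta, up to constants.
   Otherwise H^2 zeta \sum_h L_h is already of order 1.  So the bound holds in
   every context and only its mean over the contexts matters.  Values differ by
   at most the total variation distance, as total rewards lie in [0, 1].

   For the mean of \sum_h L_h, the square roots of the likelihood ratios of all
   segments are multiplied into one variable of mean at most |M|^H.  A union
   bound over the segments would cost a factor log H.  As zeta is arbitrary so
   far, it does not matter whether C0 is the right constant for the maximum
   likelihood estimator: it only enters the tuning of zeta. *)

(** * Sums over tuples and elementary bounds on square roots *)

Lemma sum_tuple0 (V : nmodType) (T : finType) (F : seq T -> V) :
  \sum_(x : 0.-tuple T) F x = F [::].
Proof.
rewrite (big_pred1 [tuple]) => [//|x].
by rewrite /= tuple0; apply/esym/eqP.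
Qed.

Lemma sum_tupleS (V : nmodType) (T : finType) n (F : seq T -> V) :
  \sum_(x : n.+1.-tuple T) F x = \sum_(t : T) \sum_(x : n.-tuple T) F (t :: x).
Proof.
rewrite pair_big /=.
rewrite (reindex (fun p : T * n.-tuple T => [tuple of p.1 :: p.2])) //=.
exists (fun x : n.+1.-tuple T => (thead x, [tuple of behead x])) => [[t x] _|x _].
  by congr pair; apply: val_inj.
by rewrite [RHS]tuple_eta; apply: val_inj.
Qed.

Lemma sum_pairE (V : nmodType) (S A : finType) (F : S * A -> V) :
  \sum_(x : S * A) F x = \sum_(s : S) \sum_(a : A) F (s, a).
Proof. by rewrite pair_big /=; apply: eq_bigr => -[]. Qed.

Lemma sum_sqrt_le (R : realType) (T : finType) (p q : T -> R) :
  (forall t, 0 <= p t) -> (forall t, 0 <= q t) ->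
  \sum_t Num.sqrt (p t * q t) <= (\sum_t p t + \sum_t q t) / 2.
Proof.
move=> p0 q0; rewrite -big_split /= mulr_suml; apply: ler_sum => t _.
rewrite sqrtrM //.
have := sqr_ge0 (Num.sqrt (p t) - Num.sqrt (q t)).
rewrite sqrrB !sqr_sqrtr //; lra.
Qed.

(** Completing the square: with x and y the roots of [m] and [v], the right side is at least (x - y
    (1 - t))^2 + y^2 t (2 - t), and [t <= 1] because [B >= 0]. *)
Lemma sqrt_overlap_le (R : realType) (m v t B : R) : 0 <= m -> 0 <= v ->
  0 <= t -> 0 <= B -> B <= 1 - t -> v * t <= m + v - 2 * (Num.sqrt (m * v) * B).
Proof.
move=> m0 v0 t0 B0 Bt; rewrite sqrtrM //.
have := sqrtr_ge0 m; have := sqrtr_ge0 v.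
have := sqr_sqrtr m0; have := sqr_sqrtr v0.
move: (Num.sqrt m) (Num.sqrt v) => x y <- <- y0 x0.
have : x * y * B <= x * y * (1 - t) by rewrite ler_wpM2l // !mulr_ge0.
have := sqr_ge0 (x - y * (1 - t)).
have : 0 <= y ^+ 2 * (t * (1 - t)) by rewrite mulr_ge0 ?sqr_ge0 // mulr_ge0 //; lra.
nra.
Qed.

(** * Distances between trajectory laws *)

Section Paths.
Variables (R : realType) (H : nat) (S A : finType).
Variables (d : measure_display) (ctx : measurableType d).
Local Notation model := (model R S A ctx).
Local Notation policy := (policy R H S A).
Implicit Types (M : model) (pi : policy) (c : ctx) (h n : nat) (mu nu : S -> R).

Lemma pol_ge0 pi h s a : 0 <= pol pi h s a.
Proof.
rewrite /pol; have [hH|hH] := ltnP h H; last first.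
  (* Beyond the horizon [nth] falls back to the zero function. *)
  by rewrite nth_default ?size_tuple ?ffunE // ffunE.
have /forallP/(_ (Ordinal hH))/forallP/(_ s)/andP[/forallP/(_ a)] := valP pi.
by rewrite (tnth_nth 0).
Qed.

Lemma pol_sum1 pi h s : (h < H)%N -> \sum_(a : A) pol pi h s a = 1.
Proof.
move=> hH; rewrite /pol.
have /forallP/(_ (Ordinal hH))/forallP/(_ s)/andP[_ /eqP] := valP pi.
by rewrite (tnth_nth 0).
Qed.

Lemma path_prob_ge0 M pi c h mu x : (forall s, 0 <= mu s) ->
  0 <= path_prob M pi c h mu x.
Proof.
elim: x h mu => [|[s a] x IH] h mu mu0 //=.
by rewrite !mulr_ge0 ?pol_ge0 // IH // => s'; exact: trans_ge0.
Qed.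

Lemma path_prob_sum M pi c n h mu : (h + n <= H)%N ->
  \sum_s mu s = 1 -> \sum_(x : n.-tuple (S * A)) path_prob M pi c h mu x = 1.
Proof.
elim: n h mu => [|n IH] h mu hn mu1; first by rewrite sum_tuple0.
rewrite sum_tupleS sum_pairE -mu1; apply: eq_bigr => s _ /=.
under eq_bigr => a _.
  rewrite -mulr_sumr IH; first over.
    lia.
  exact: trans_sum1.
rewrite -mulr_suml -mulr_sumr pol_sum1 ?mulr1 //; lia.
Qed.

(** Bhattacharyya coefficient of the laws of the [n] layers from [h] on, for initial measures [mu]
    and [nu] of any mass. *)
Definition bcoef M1 M2 pi c n h mu nu : R :=
  \sum_(x : n.-tuple (S * A))
    Num.sqrt (path_prob M1 pi c h mu x * path_prob M2 pi c h nu x).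

Lemma bcoef_ge0 M1 M2 pi c n h mu nu : 0 <= bcoef M1 M2 pi c n h mu nu.
Proof. by apply: sumr_ge0 => x _; exact: sqrtr_ge0. Qed.

(** Both laws use the same policy, so its square leaves the root as a weight. *)
Lemma bcoefS M1 M2 pi c n h mu nu :
  (forall s, 0 <= mu s) -> (forall s, 0 <= nu s) ->
  bcoef M1 M2 pi c n.+1 h mu nu =
  \sum_s Num.sqrt (mu s * nu s) * \sum_a pol pi h s a *
    bcoef M1 M2 pi c n h.+1 (trans M1 h s a c) (trans M2 h s a c).
Proof.
move=> mu0 nu0.
rewrite /bcoef.
rewrite (@sum_tupleS _ _ n (fun x =>
  Num.sqrt (path_prob M1 pi c h mu x * path_prob M2 pi c h nu x))).
rewrite sum_pairE; apply: eq_bigr => s _.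
rewrite mulr_sumr; apply: eq_bigr => a _.
rewrite !mulr_sumr; apply: eq_bigr => x _ /=.
have p0 := pol_ge0 pi h s a.
rewrite [X in Num.sqrt X](_ : _ = (mu s * nu s) * (pol pi h s a) ^+ 2 *
  (path_prob M1 pi c h.+1 (trans M1 h s a c) x *
   path_prob M2 pi c h.+1 (trans M2 h s a c) x)); last by ring.
rewrite [LHS]sqrtrM; last by rewrite !mulr_ge0 ?exprn_ge0.
by rewrite [X in X * _]sqrtrM ?mulr_ge0 // sqrtr_sqr ger0_norm // mulrA.
Qed.

Lemma bcoef_le1 M1 M2 pi c n h mu nu : (h + n <= H)%N ->
  (forall s, 0 <= mu s) -> (forall s, 0 <= nu s) ->
  \sum_s mu s = 1 -> \sum_s nu s = 1 -> bcoef M1 M2 pi c n h mu nu <= 1.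
Proof.
move=> hn mu0 nu0 mu1 nu1; rewrite /bcoef.
apply: le_trans (sum_sqrt_le _ _) _ => [x|x|]; try exact: path_prob_ge0.
rewrite !path_prob_sum //; lra.
Qed.

(** Forgetting all but the first state can only increase the coefficient, because the later factors
    are at most 1. *)
Lemma bcoef_le_init M1 M2 pi c n h mu nu : (h + n.+1 <= H)%N ->
  (forall s, 0 <= mu s) -> (forall s, 0 <= nu s) ->
  bcoef M1 M2 pi c n.+1 h mu nu <= \sum_s Num.sqrt (mu s * nu s).
Proof.
move=> hn mu0 nu0; rewrite bcoefS //; apply: ler_sum => s _.
rewrite ler_piMr ?sqrtr_ge0 //.
rewrite -(@pol_sum1 pi h s); last by lia.
apply: ler_sum => a _; rewrite ler_piMr ?pol_ge0 //.
by apply: bcoef_le1; rewrite ?trans_sum1 //; try lia; move=> s'; exact: trans_ge0.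
Qed.

(** Squared Hellinger distance between the two kernels. *)
Definition hell M1 M2 c h (s : S) (a : A) : R :=
  1 - \sum_s' Num.sqrt (trans M1 h s a c s' * trans M2 h s a c s').

Lemma hell_ge0 M1 M2 c h s a : 0 <= hell M1 M2 c h s a.
Proof.
rewrite subr_ge0; apply: le_trans (sum_sqrt_le _ _) _; try exact: trans_ge0.
rewrite !trans_sum1; lra.
Qed.

Lemma sqrt_sub_le_hell M1 M2 c h s a :
  \sum_s' (Num.sqrt (trans M1 h s a c s') - Num.sqrt (trans M2 h s a c s')) ^+ 2
    = 2 * hell M1 M2 c h s a.
Proof.
rewrite /hell mulrBr mulr1.
under eq_bigr => s' _ do rewrite sqrrB !sqr_sqrtr ?trans_ge0 // -sqrtrM ?trans_ge0 //.
rewrite big_split /= sumrB !trans_sum1 sumrMnl; ring.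
Qed.

(* Expectation under M2 of the Hellinger loss of layer h + j, from s at h. *)
Fixpoint hell_at M1 M2 pi c (j h : nat) (s : S) : R :=
  \sum_a pol pi h s a *
    (if j is j'.+1
     then \sum_s' trans M2 h s a c s' * hell_at M1 M2 pi c j' h.+1 s'
     else hell M1 M2 c h s a).

(* The statement is for unnormalized mu and nu: the induction applies it to
   mu s * trans M1 h s a and nu s * trans M2 h s a separately for each (s, a),
   so that no constant is lost from one layer to the next. *)
Lemma hell_at_le M1 M2 pi c j n h mu nu :
  (j.+1 < n)%N -> (h + n <= H)%N ->
  (forall s, 0 <= mu s) -> (forall s, 0 <= nu s) ->
  \sum_s nu s * hell_at M1 M2 pi c j h s <=
  \sum_s mu s + \sum_s nu s - 2 * bcoef M1 M2 pi c n h mu nu.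
Proof.
elim: j n h mu nu => [|j IH] [//|n] h mu nu jn hn mu0 nu0.
all: rewrite bcoefS // -big_split /= mulr_sumr -sumrB; apply: ler_sum => s _.
all: have p1 : \sum_a pol pi h s a = 1 by (apply: pol_sum1; lia).
all: rewrite -[mu s + nu s]mulr1 -{1}p1 !mulr_sumr -sumrB; apply: ler_sum => a _.
all: rewrite [leLHS]mulrCA [X in _ <= X - _]mulrC [X in _ <= _ - X]mulrA.
all: rewrite [X in _ <= _ - X]mulrCA -mulrBr ler_wpM2l ?pol_ge0 //.
  (* Kernel [h] shows only in the state of layer [h.+1], so that layer must be among the remaining
     ones: this is where [j.+1 < n] enters. *)
  have Bh : bcoef M1 M2 pi c n h.+1 (trans M1 h s a c) (trans M2 h s a c)
      <= 1 - hell M1 M2 c h s a.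
    case: n jn hn => [//|n] jn hn.
    apply: le_trans (bcoef_le_init _ _ _ _ _ _ _) _; try exact: trans_ge0; try lia.
    by rewrite /hell subKr.
  by rewrite -mulrA; apply: sqrt_overlap_le; rewrite // ?hell_ge0 ?bcoef_ge0.
have := IH n h.+1 (fun s' => mu s * trans M1 h s a c s')
  (fun s' => nu s * trans M2 h s a c s').
(* For [n > 0] the coefficient scales with the root of each initial measure. *)
have -> : bcoef M1 M2 pi c n h.+1 (fun s' : S => mu s * trans M1 h s a c s')
       (fun s' : S => nu s * trans M2 h s a c s') =
   Num.sqrt (mu s * nu s) * bcoef M1 M2 pi c n h.+1 (trans M1 h s a c) (trans M2 h s a c).
  case: n jn {hn} => [//|n] jn.
  rewrite !bcoefS; try (by move=> s'; rewrite ?mulr_ge0 ?trans_ge0).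
  rewrite mulr_sumr; apply: eq_bigr => s' _; rewrite [RHS]mulrA; congr (_ * _).
  by rewrite -sqrtrM ?mulr_ge0 //; congr Num.sqrt; ring.
rewrite -!mulr_sumr !trans_sum1 !mulr1.
have -> : \sum_i nu s * trans M2 h s a c i * hell_at M1 M2 pi c j h.+1 i =
  nu s * \sum_i trans M2 h s a c i * hell_at M1 M2 pi c j h.+1 i.
  by rewrite mulr_sumr; apply: eq_bigr => i _; rewrite mulrA.
rewrite mulrA; apply; try lia; by move=> s'; rewrite mulr_ge0 ?trans_ge0.
Qed.

Fixpoint occ M s1 pi c h (s : S) : R :=
  if h is k.+1 then
    \sum_(x : S * A) occ M s1 pi c k x.1 * pol pi k x.1 x.2 * trans M k x.1 x.2 c s
  else (s == s1)%:R.

Lemma occ_ge0 M s1 pi c h s : 0 <= occ M s1 pi c h s.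
Proof.
elim: h s => [|h IH] s /=; first by rewrite ler0n.
by apply: sumr_ge0 => x _; rewrite !mulr_ge0 ?pol_ge0 ?trans_ge0.
Qed.

Lemma sum_init (s1 : S) : \sum_s (s == s1)%:R = 1 :> R.
Proof. by rewrite (bigD1 s1) //= eqxx big1 ?addr0 // => s /negPf ->. Qed.

(** Pushing the occupancy one layer forward is dual to pulling the loss one layer back. *)
Lemma occ_hell_at M1 M2 s1 pi c j h :
  \sum_s occ M2 s1 pi c h s * hell_at M1 M2 pi c j h s =
  \sum_s occ M2 s1 pi c (h + j) s * hell_at M1 M2 pi c 0 (h + j) s.
Proof.
elim: j h => [|j IH] h; first by rewrite addn0.
rewrite addnS -addSn -IH /=.
under [RHS]eq_bigr do rewrite mulr_suml.
rewrite exchange_big /= sum_pairE; apply: eq_bigr => s _ /=.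
rewrite mulr_sumr; apply: eq_bigr => a _.
rewrite !mulr_sumr; apply: eq_bigr => s' _; ring.
Qed.

Definition bhatt s1 M1 M2 pi c : R :=
  \sum_(x : traj H S A) Num.sqrt (traj_prob s1 M1 pi c x * traj_prob s1 M2 pi c x).

(** This is [hell_at_le] from layer 0, where both laws start in [s1] with mass 1, keeping a single
    pair of layer [h]. The last layer is excluded because its next state is not part of the
    trajectory. *)
Lemma occ_hell_le s1 M1 M2 pi c h s a : (h.+1 < H)%N ->
  occ M2 s1 pi c h s * pol pi h s a * hell M1 M2 c h s a
    <= 2 * (1 - bhatt s1 M1 M2 pi c).
Proof.
move=> hH.
have i0 (s' : S) : 0 <= (s' == s1)%:R :> R by exact: ler0n.
have := @hell_at_le M1 M2 pi c h H 0 _ _ hH (leqnn _) i0 i0.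
rewrite sum_init (@occ_hell_at M1 M2 s1 pi c h 0) add0n => hle.
apply: le_trans (_ : _ <= 1 + 1 - 2 * bhatt s1 M1 M2 pi c) _; last by lra.
apply: le_trans hle.
have ha s' : 0 <= hell_at M1 M2 pi c 0 h s'.
  by apply: sumr_ge0 => a' _; rewrite mulr_ge0 ?pol_ge0 ?hell_ge0.
apply: (@le_trans _ _ (occ M2 s1 pi c h s * hell_at M1 M2 pi c 0 h s)).
  rewrite -mulrA ler_wpM2l ?occ_ge0 //= (bigD1 a) //= lerDl sumr_ge0 // => a' _.
  by rewrite mulr_ge0 ?pol_ge0 ?hell_ge0.
rewrite [leRHS](bigD1 s) //= lerDl sumr_ge0 // => s' _.
by rewrite mulr_ge0 ?occ_ge0 ?ha.
Qed.

Lemma traj_prob_ge0 s1 M pi c x : 0 <= traj_prob s1 M pi c x.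
Proof. by apply: path_prob_ge0 => s; exact: ler0n. Qed.

Lemma traj_prob_sum1 s1 M pi c : \sum_(x : traj H S A) traj_prob s1 M pi c x = 1.
Proof. by apply: path_prob_sum; rewrite ?sum_init. Qed.

Lemma bhatt_ge0 s1 M1 M2 pi c : 0 <= bhatt s1 M1 M2 pi c.
Proof. by apply: sumr_ge0 => x _; exact: sqrtr_ge0. Qed.

Lemma bhatt_le1 s1 M1 M2 pi c : bhatt s1 M1 M2 pi c <= 1.
Proof.
apply: le_trans (sum_sqrt_le _ _) _ => [x|x|]; try exact: traj_prob_ge0.
rewrite !traj_prob_sum1; lra.
Qed.

(** The positive part alone gives the total variation distance, since both laws have mass 1. *)
Definition tvdist s1 M1 M2 pi c : R :=
  \sum_(x : traj H S A) Num.max 0 (traj_prob s1 M1 pi c x - traj_prob s1 M2 pi c x).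

Lemma tvdist_le1 s1 M1 M2 pi c : tvdist s1 M1 M2 pi c <= 1.
Proof.
rewrite -(traj_prob_sum1 s1 M1 pi c); apply: ler_sum => x _.
have := traj_prob_ge0 s1 M1 pi c x; have := traj_prob_ge0 s1 M2 pi c x.
move: (traj_prob _ _ _ _ _) (traj_prob _ _ _ _ _) => u v u0 v0.
by rewrite ge_max v0 /=; lra.
Qed.

(** Total variation distance between the laws of the [n] layers after [h], given the state [s] and
    the action at [h], averaged over the action. *)
Definition next_tv M1 M2 pi c n h (s : S) : R :=
  \sum_a pol pi h s a * \sum_(x : n.-tuple (S * A))
    Num.max 0 (path_prob M1 pi c h.+1 (trans M1 h s a c) x -
               path_prob M2 pi c h.+1 (trans M2 h s a c) x).

(** Cost of replacing one kernel: an untrusted next state is charged its whole mass under [M1], a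
    trusted one only the excess over [M2]. *)
Definition step_err M1 M2 c (tr : pred S) h s a : R :=
  \sum_(s' | ~~ tr s') trans M1 h s a c s' +
  \sum_(s' | tr s') Num.max 0 (trans M1 h s a c s' - trans M2 h s a c s').

Lemma next_tv0 M1 M2 pi c h s : next_tv M1 M2 pi c 0 h s = 0.
Proof.
rewrite /next_tv big1 // => a _.
rewrite (@sum_tuple0 _ _ (fun x => Num.max 0 (path_prob M1 pi c h.+1 (trans M1 h s a c) x -
               path_prob M2 pi c h.+1 (trans M2 h s a c) x))) /= subrr.
by rewrite maxxx mulr0.
Qed.

(** On an untrusted next state the difference is at most the mass under [M1]. On a trusted one, p u
    - q v = p (u - v) + v (p - q), where p and q are the transition probabilities and u and v those
    of the remaining path; v sums to 1. *)
Lemma next_tvS M1 M2 pi c n h s (tr : A -> pred S) : (h.+1 + n.+1 <= H)%N ->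
  next_tv M1 M2 pi c n.+1 h s <= \sum_a pol pi h s a *
    (step_err M1 M2 c (tr a) h s a +
     \sum_(s' | tr a s') trans M1 h s a c s' * next_tv M1 M2 pi c n h.+1 s').
Proof.
move=> hn; apply: ler_sum => a _; rewrite ler_wpM2l ?pol_ge0 //.
rewrite (@sum_tupleS _ _ n (fun x =>
  Num.max 0 (path_prob M1 pi c h.+1 (trans M1 h s a c) x -
             path_prob M2 pi c h.+1 (trans M2 h s a c) x))).
rewrite sum_pairE (bigID (tr a)) /= addrC /step_err -addrA -big_split /=.
have P2 s' a' : \sum_(i : n.-tuple (S * A))
    path_prob M2 pi c h.+2 (trans M2 h.+1 s' a' c) i = 1.
  by apply: path_prob_sum; rewrite ?trans_sum1 //; lia.
have P1 s' a' : \sum_(i : n.-tuple (S * A))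
    path_prob M1 pi c h.+2 (trans M1 h.+1 s' a' c) i = 1.
  by apply: path_prob_sum; rewrite ?trans_sum1 //; lia.
have Q s' : \sum_a' pol pi h.+1 s' a' = 1 by apply: pol_sum1; lia.
have pge M x s' a' : 0 <= path_prob M pi c h.+2 (trans M h.+1 s' a' c) x.
  by apply: path_prob_ge0 => ?; exact: trans_ge0.
apply: lerD; apply: ler_sum => s' _.
  rewrite -[leRHS]mulr1 -(Q s') mulr_sumr; apply: ler_sum => a' _.
  rewrite -[leRHS]mulr1 -(P1 s' a') mulr_sumr; apply: ler_sum => x _.
  rewrite ge_max !mulr_ge0 ?pol_ge0 ?trans_ge0 //= lerBlDr lerDl.
  by rewrite !mulr_ge0 ?pol_ge0 ?trans_ge0.
rewrite /next_tv -[X in X + _]mulr1 -(Q s') !mulr_sumr -big_split /=.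
apply: ler_sum => a' _.
rewrite -[X in X + _]mulr1 -(P2 s' a') !mulr_sumr -big_split /=.
apply: ler_sum => x _.
have u0 := pge M1 x s' a'; have v0 := pge M2 x s' a'.
have := trans_ge0 M1 h s a c s'; have := trans_ge0 M2 h s a c s'.
have := pol_ge0 pi h.+1 s' a'.
move: (path_prob _ _ _ _ _ _) (path_prob _ _ _ _ _ _) u0 v0 => v u u0 v0.
move: (trans _ _ _ _ _ _) (trans _ _ _ _ _ _) (pol _ _ _ _) => p q w w0 q0 p0.
have m1 : p - q <= Num.max 0 (p - q) by rewrite le_max lexx orbT.
have m2 : u - v <= Num.max 0 (u - v) by rewrite le_max lexx orbT.
have m3 : 0 <= Num.max 0 (p - q) by rewrite le_max lexx.
have m4 : 0 <= Num.max 0 (u - v) by rewrite le_max lexx.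
rewrite ge_max; apply/andP; split; first by rewrite addr_ge0 // !mulr_ge0.
have : 0 <= w * v * (Num.max 0 (p - q) - (p - q)) by rewrite !mulr_ge0 // subr_ge0.
have : 0 <= w * p * (Num.max 0 (u - v) - (u - v)) by rewrite !mulr_ge0 // subr_ge0.
nra.
Qed.

(* Hybrid argument along the trusted occupancies dt of M1. *)
Lemma sum_next_tv_le M1 M2 pi c (tr : nat -> S -> A -> pred S) (dt : nat -> S -> R) :
  (forall h s, 0 <= dt h s) ->
  (forall h s', dt h.+1 s' = \sum_(x : S * A | tr h x.1 x.2 s')
     dt h x.1 * pol pi h x.1 x.2 * trans M1 h x.1 x.2 c s') ->
  forall n h, (h.+1 + n <= H)%N ->
  \sum_s dt h s * next_tv M1 M2 pi c n h s <=
  \sum_(h <= k < h + n) \sum_(x : S * A) dt k x.1 * pol pi k x.1 x.2 *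
     step_err M1 M2 c (tr k x.1 x.2) k x.1 x.2.
Proof.
move=> dt0 dtS; elim=> [|n IH] h hn.
  rewrite big1 => [|s _]; last by rewrite next_tv0 mulr0.
  by rewrite addn0 big_geq.
rewrite big_ltn; last by lia.
have -> : (h + n.+1 = h.+1 + n)%N by lia.
apply: le_trans (lerD (lexx _) (IH h.+1 _)); last by lia.
under [X in _ <= _ + X]eq_bigr => s' _.
  rewrite dtS mulr_suml big_mkcond /=; over.
rewrite exchange_big /= -big_split /= sum_pairE; apply: ler_sum => s _ /=.
apply: le_trans (ler_wpM2l (dt0 h s) (@next_tvS M1 M2 pi c n h s (tr h s) _)) _.
  by lia.
rewrite mulr_sumr; apply: ler_sum => a _.
rewrite [leLHS]mulrA mulrDr lerD2l big_mkcond mulr_sumr /=; apply: ler_sum => s' _.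
by case: ifP => _; rewrite ?mulr0 // !mulrA.
Qed.

(** The first state and action have the same law in both models, so only the [H.-1] transitions
    contribute. *)
Lemma tvdist_hybrid s1 M1 M2 pi c (tr : nat -> S -> A -> pred S) (dt : nat -> S -> R) :
  (0 < H)%N -> (forall s, dt 0%N s = (s == s1)%:R) ->
  (forall h s, 0 <= dt h s) ->
  (forall h s', dt h.+1 s' = \sum_(x : S * A | tr h x.1 x.2 s')
     dt h x.1 * pol pi h x.1 x.2 * trans M1 h x.1 x.2 c s') ->
  tvdist s1 M1 M2 pi c <=
  \sum_(0 <= k < H.-1) \sum_(x : S * A) dt k x.1 * pol pi k x.1 x.2 *
     step_err M1 M2 c (tr k x.1 x.2) k x.1 x.2.
Proof.
move=> H0 dt_init dt0 dtS.
apply: le_trans (sum_next_tv_le M2 dt0 dtS (n := H.-1) (h := 0) _); last by lia.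
rewrite /tvdist /traj_prob /traj.
have [n Hn] : exists n, H = n.+1 by exists H.-1; lia.
pose gap (x : seq (S * A)) := Num.max 0
  (path_prob M1 pi c 0 (fun s => (s == s1)%:R) x -
   path_prob M2 pi c 0 (fun s => (s == s1)%:R) x).
have -> : \sum_(x : H.-tuple (S * A)) Num.max 0
     (path_prob M1 pi c 0 (fun s => (s == s1)%:R) x -
      path_prob M2 pi c 0 (fun s => (s == s1)%:R) x)
  = \sum_(x : n.+1.-tuple (S * A)) gap x by rewrite -Hn.
rewrite (@sum_tupleS _ _ n gap).
have -> : H.-1 = n by lia.
rewrite sum_pairE; apply: ler_sum => s _ /=.
rewrite dt_init /next_tv mulr_sumr; apply: ler_sum => a _.
rewrite !mulr_sumr; apply: ler_sum => x _.
rewrite /gap /= -mulrBr; case: (s == s1); rewrite ?mul0r ?maxxx // !mul1r.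
by rewrite maxr_pMr ?pol_ge0 // mulr0.
Qed.

End Paths.

(** * Elementary inequalities behind the comparison of kernels *)

Lemma bernoulli_half (R : realFieldType) (h H : nat) : (0 < H)%N -> (h <= H)%N ->
  1 / 2 <= (1 - (2 * H%:R)^-1) ^+ h :> R.
Proof.
move=> H0 hH; have H0' : 1 <= H%:R :> R by rewrite ler1n.
have u0 : 0 <= (2 * H%:R)^-1 :> R by rewrite invr_ge0; lra.
have u1 : (2 * H%:R)^-1 <= 1 :> R by rewrite invf_le1; lra.
have B k : 1 - k%:R * (2 * H%:R)^-1 <= (1 - (2 * H%:R)^-1) ^+ k :> R.
  elim: k => [|k IH]; first by rewrite mul0r subr0 expr0.
  rewrite exprS; apply: le_trans (ler_wpM2l _ IH); last by lra.
  have : 0 <= k%:R :> R by exact: ler0n.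
  rewrite -[k.+1%:R]natr1; move: (_^-1) u0 u1 => u u0 u1 k0.
  have : 0 <= k%:R * u * u by rewrite !mulr_ge0.
  lra.
apply: le_trans (B h).
have : h%:R * (2 * H%:R)^-1 <= 1 / 2 :> R.
  rewrite ler_pdivrMr; last by lra.
  have : h%:R <= H%:R :> R by rewrite ler_nat.
  lra.
lra.
Qed.

(** The hypothesis says that the roots differ by at most a fraction 1 / (4 K) of the root of [p],
    and (1 - 1 / (4 K))^2 >= 1 - 1 / (2 K). *)
Lemma sqrt_close_le (R : rcfType) (p q K : R) : 0 <= p -> 0 <= q -> 1 <= K ->
  16 * K ^+ 2 * (Num.sqrt p - Num.sqrt q) ^+ 2 <= p -> p * (1 - (2 * K)^-1) <= q.
Proof.
move=> p0 q0 K1; have := sqrtr_ge0 p; have := sqrtr_ge0 q.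
have := sqr_sqrtr p0; have := sqr_sqrtr q0.
move: (Num.sqrt p) (Num.sqrt q) => x y <- <- y0 x0 h.
have h1 : 4 * K * (x - y) <= x.
  have [xy|xy] := leP x y.
    by apply: (le_trans _ x0); rewrite mulr_ge0_le0 //; lra.
  rewrite -(@ler_pXn2r _ 2) ?nnegrE // ?mulr_ge0 //; try lra.
have Ki : K * K^-1 = 1 by rewrite divff //; lra.
have k0 : 0 <= K^-1 by rewrite invr_ge0; lra.
have k1 : K^-1 <= 1 by rewrite invf_le1; lra.
rewrite invfM.
have h2 : x * (1 - K^-1 / 4) <= y.
  have := ler_wpM2l k0 h1.
  rewrite (_ : K^-1 * (4 * K * (x - y)) = K * K^-1 * 4 * (x - y)); last by ring.
  rewrite Ki; lra.
move: (K^-1) k0 k1 h2 {Ki} => k k0 k1 h2.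
have h3 : (x * (1 - k / 4)) ^+ 2 <= y ^+ 2.
  rewrite ler_pXn2r ?nnegrE // mulr_ge0 //; lra.
apply: le_trans h3.
rewrite exprMn ler_wpM2l ?sqr_ge0 //.
have := sqr_ge0 k; lra.
Qed.

(** With x and y the roots, p - q = 2 x (x - y) - (x - y)^2; the last square is dropped and the
    product is split by the inequality of means with weight [k]. *)
Lemma sub_le_sqrt (R : rcfType) (p q k : R) : 0 <= p -> 0 <= q -> 0 < k ->
  Num.max 0 (p - q) <= k * (Num.sqrt p - Num.sqrt q) ^+ 2 + p / k.
Proof.
move=> p0 q0 k0; have ki : 0 < k^-1 by rewrite invr_gt0.
rewrite ge_max; apply/andP; split.
  by rewrite addr_ge0 // mulr_ge0 ?sqr_ge0 // ltW.
have := sqrtr_ge0 p; have := sqrtr_ge0 q.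
have := sqr_sqrtr p0; have := sqr_sqrtr q0.
move: (Num.sqrt p) (Num.sqrt q) => x y <- <- y0 x0.
have : 0 <= k^-1 * (k * (x - y) - x) ^+ 2 by rewrite mulr_ge0 ?sqr_ge0 // ltW.
have -> : k^-1 * (k * (x - y) - x) ^+ 2 =
   k * (x - y) ^+ 2 + x ^+ 2 / k - 2 * x * (x - y) by field; lra.
have := sqr_ge0 (x - y).
nra.
Qed.

(** * Trusted occupancies in a fixed context *)

Section TrustedOccupancy.
Variables (R : realType) (H : nat) (S A : finType) (s1 : S).
Variables (d : measure_display) (ctx : measurableType d).
Local Notation model := (model R S A ctx).
Local Notation policy := (policy R H S A).
Variables (alg : inputs R H S A ctx) (m : nat) (Mprev : model) (c : ctx).
Implicit Types (outs : seq model) (pi : policy).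

Local Notation docc := (docc s1 alg m Mprev).
Local Notation trusted := (trusted s1 alg m Mprev).

(** Layer [h] only uses the first [h] outputs, so what segment [h] computes agrees with what the
    analysis reads off the full list. *)
Lemma docc_ext outs outs' h :
  (forall k, (k < h)%N -> nth Mprev outs k = nth Mprev outs' k) ->
  docc outs h c = docc outs' h c.
Proof.
elim: h => [//|h IH] eqo; apply: funext => pi; apply: funext => s /=.
rewrite IH; last by move=> k kh; apply: eqo; lia.
rewrite /trusted /= eqo //.
Qed.

Lemma docc_ge0 outs h pi s : 0 <= docc outs h c pi s.
Proof.
elim: h s => [|h IH] s /=; first by rewrite ler0n.
by apply: sumr_ge0 => x _; rewrite !mulr_ge0 ?pol_ge0 ?trans_ge0.
Qed.

(** Dropping the untrusted transitions can only lose mass. *)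
Lemma docc_mass outs h pi : (h <= H)%N -> \sum_s docc outs h c pi s <= 1.
Proof.
elim: h => [|h IH] hH /=; first by rewrite sum_init.
apply: le_trans (IH _); last by lia.
apply: le_trans (_ : _ <= \sum_(x : S * A) docc outs h c pi x.1 * pol pi h x.1 x.2) _.
  under eq_bigr do rewrite big_mkcond.
  rewrite exchange_big /=; apply: ler_sum => x _.
  rewrite -[leRHS]mulr1 -(trans_sum1 (nth Mprev outs h) h x.1 x.2 c) mulr_sumr.
  apply: ler_sum => s _; case: ifP => // _.
  by rewrite !mulr_ge0 ?pol_ge0 ?trans_ge0 ?docc_ge0.
rewrite sum_pairE; apply: ler_sum => s _ /=.
by rewrite -mulr_sumr pol_sum1 ?mulr1.
Qed.

Hypothesis reg0 : forall pi, reg s1 Mprev pi c = 0.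
Hypothesis argmax_explore : forall outs s a,
  is_argmax (score s1 alg m Mprev outs (size outs) c s a)
    (lo_explore alg m Mprev outs s a c).

Let SA : R := #|S|%:R * #|A|%:R.

Lemma penaltyE pi : penalty s1 alg m Mprev pi c = SA.
Proof. by rewrite /penalty reg0 mulr0 addr0. Qed.

(** The policy chosen for [(s, a)] in segment [k], recovered from the full list of outputs. *)
Definition explorer outs k s a := lo_explore alg m Mprev (take k outs) s a c.

Hypothesis A0 : (0 < #|A|)%N.

Let S1 : 1 <= #|S|%:R :> R.
Proof. by rewrite ler1n; apply/card_gt0P; exists s1. Qed.

Let A1 : 1 <= #|A|%:R :> R.
Proof. by rewrite ler1n. Qed.

Let SA1 : 1 <= SA.
Proof. by rewrite /SA mulr_ege1. Qed.

(** Without regret the penalty is constant, so maximizing the score maximizes the trusted occupancy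
    itself. *)
Lemma docc_explorer outs k s a pi : (k <= size outs)%N ->
  docc outs k c pi s * pol pi k s a <=
  docc outs k c (explorer outs k s a) s * pol (explorer outs k s a) k s a.
Proof.
move=> ks; have := @argmax_explore (take k outs) s a pi.
rewrite /score size_takel // !penaltyE -/(explorer outs k s a).
rewrite (@docc_ext (take k outs) outs); last first.
  by move=> j jk; rewrite nth_take.
by rewrite ler_pM2r // invr_gt0; apply: lt_le_trans SA1.
Qed.

(** The supremum in [trusted] is attained at the explorer. *)
Lemma trustedP outs k s a s' : (k <= size outs)%N ->
  trusted outs (docc outs k c) k c s a s' =
  ((zeta_m alg m)^-1 * SA <= docc outs k c (explorer outs k s a) s *
     pol (explorer outs k s a) k s a * trans (assemble Mprev outs) k s a c s').
Proof.
move=> ks; have SA0 : 0 < SA by apply: lt_le_trans SA1.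
rewrite -ler_pdivlMr // /trusted.
set f := fun pi : policy => _.
suff -> : sup (range f) = f (explorer outs k s a).
  by rewrite /f penaltyE mulrAC.
have mx pi : f pi <= f (explorer outs k s a).
  rewrite /f !penaltyE ler_wpM2r ?trans_ge0 // ler_wpM2r //.
    by rewrite invr_ge0 ltW.
  exact: docc_explorer.
apply/eqP; rewrite eq_le; apply/andP; split.
  apply: ge_sup; first by exists (f (explorer outs k s a)), (explorer outs k s a).
  by move=> _ [pi _ <-].
apply: ub_le_sup; last by exists (explorer outs k s a).
by exists (f (explorer outs k s a)) => _ [pi _ <-].
Qed.

Lemma card_candidates outs : (0 < size (candidates alg m Mprev outs c))%N /\
  (size (candidates alg m Mprev outs c))%:R <= 2 * SA.
Proof.
split.
  have : lo_greedy alg Mprev c \in candidates alg m Mprev outs c.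
    by rewrite mem_undup inE eqxx.
  by case: (candidates _ _ _ _ _).
apply: (@le_trans _ _ (#|S| * #|A|).+1%:R).
  rewrite ler_nat; apply: leq_trans (size_undup _) _.
  by rewrite /= size_map -cardE card_prod.
by rewrite -natr1 natrM -/SA; have := SA1; lra.
Qed.

Lemma play_probE outs pi :
  play_prob s1 alg m Mprev outs c pi = (size (candidates alg m Mprev outs c))%:R^-1.
Proof.
rewrite /play_prob reg0 mulr0 addr0; congr (_^-1).
have [+ _] := card_candidates outs.
rewrite /lambda; set cs := candidates _ _ _ _ _ => n0.
have E (l : R) : \sum_(p <- cs) (l + eta_m alg m * reg s1 Mprev p c)^-1 = (size cs)%:R / l.
  under eq_bigr do rewrite reg0 mulr0 addr0.
  by rewrite big_const_seq count_predT iter_addr_0 mulr_natl.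
(* Without regret the normalization reads size / l = 1, so [xget] can only return the number of
   candidates. *)
case: xgetP => [l _ [l0]|/(_ (size cs)%:R)[]].
  by rewrite E => /(canRL (mulfVK (lt0r_neq0 l0))); rewrite mul1r.
by rewrite /= E divff ?pnatr_eq0 -?lt0n // ltr0n.
Qed.

Variable Mstar : model.

Definition bavg outs (M : model) : R :=
  \sum_(pi <- candidates alg m Mprev outs c)
    play_prob s1 alg m Mprev outs c pi * bhatt s1 M Mstar pi c.

Lemma play_prob_sum1 outs :
  \sum_(pi <- candidates alg m Mprev outs c) play_prob s1 alg m Mprev outs c pi = 1.
Proof.
under eq_bigr do rewrite play_probE.
rewrite big_const_seq count_predT iter_addr_0 -[LHS]mulr_natl divff // pnatr_eq0 -lt0n.
by have [] := card_candidates outs.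
Qed.

Lemma play_prob_ge0 outs pi : 0 <= play_prob s1 alg m Mprev outs c pi.
Proof. by rewrite play_probE invr_ge0 ler0n. Qed.

Lemma bavg_ge0 outs M : 0 <= bavg outs M.
Proof. by apply: sumr_ge0 => pi _; rewrite mulr_ge0 ?play_prob_ge0 ?bhatt_ge0. Qed.

Lemma bavg_le1 outs M : bavg outs M <= 1.
Proof.
rewrite -(play_prob_sum1 outs); apply: ler_sum => pi _.
by rewrite ler_piMr ?play_prob_ge0 ?bhatt_le1.
Qed.

(** There are at most SA + 1 candidates, so each is played with probability at least 1 / (2 SA); the
    terms of the others are nonnegative. *)
Lemma bhatt_candidate outs M pi : pi \in candidates alg m Mprev outs c ->
  1 - bhatt s1 M Mstar pi c <= 2 * SA * (1 - bavg outs M).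
Proof.
move=> pic; have [n0 nSA] := card_candidates outs.
apply: le_trans (ler_wpM2r _ nSA); last by rewrite subr_ge0 bavg_le1.
rewrite -[X in _ * (X - _)](play_prob_sum1 outs) /bavg -sumrB.
rewrite (bigD1_seq pi) ?undup_uniq //= mulrDr.
rewrite play_probE [X in _ <= X + _](_ : _ = 1 - bhatt s1 M Mstar pi c); last first.
  by field; rewrite pnatr_eq0 -lt0n.
rewrite lerDl.
rewrite mulr_ge0 ?ler0n // sumr_ge0 // => p _.
by rewrite subr_ge0 ler_piMr ?play_prob_ge0 ?bhatt_le1.
Qed.

Lemma mem_explorer outs k s a :
  explorer outs k s a \in candidates alg m Mprev (take k outs) c.
Proof.
rewrite mem_undup inE; apply/orP; right.
by apply/mapP; exists (s, a) => //; rewrite mem_enum.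
Qed.

End TrustedOccupancy.

(** * From the losses of the segments to a total variation bound in a fixed context *)

Section PointwiseBound.
Variables (R : realType) (H : nat) (S A : finType) (s1 : S).
Variables (d : measure_display) (ctx : measurableType d).
Local Notation model := (model R S A ctx).
Local Notation policy := (policy R H S A).
Variables (alg : inputs R H S A ctx) (m : nat) (Mprev : model) (c : ctx).
Hypothesis reg0 : forall pi : policy, reg s1 Mprev pi c = 0.
Hypothesis argmax_explore : forall outs s a,
  is_argmax (score s1 alg m Mprev outs (size outs) c s a)
    (lo_explore alg m Mprev outs s a c).
Hypothesis A0 : (0 < #|A|)%N.
Variables (Mstar : model) (outs : seq model).
Hypothesis H0 : (0 < H)%N.
Hypothesis sz_outs : size outs = H.

Let SA : R := #|S|%:R * #|A|%:R.
Let Mhat := assemble Mprev outs.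
Let zeta := zeta_m alg m.
Hypothesis zeta0 : 0 < zeta.

Let S1 : 1 <= #|S|%:R :> R.
Proof. by rewrite ler1n; apply/card_gt0P; exists s1. Qed.

Let A1 : 1 <= #|A|%:R :> R.
Proof. by rewrite ler1n. Qed.

Let Spos : 0 < #|S|%:R :> R.
Proof. exact: lt_le_trans S1. Qed.

Let Apos : 0 < #|A|%:R :> R.
Proof. exact: lt_le_trans A1. Qed.

Let SA1 : 1 <= SA.
Proof. by rewrite /SA mulr_ege1. Qed.

Let HR1 : 1 <= H%:R :> R.
Proof. by rewrite ler1n. Qed.

Local Notation explorer := (explorer alg m Mprev c outs).
Local Notation docc := (docc s1 alg m Mprev outs).
Local Notation docc_expl k s a :=
  (docc k c (explorer k s a) s * pol (explorer k s a) k s a).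
Local Notation occ_expl k s a :=
  (occ Mstar s1 (explorer k s a) c k s * pol (explorer k s a) k s a).
Local Notation tr k := (trusted s1 alg m Mprev outs (docc k c) k c).

Definition loss k := 1 - bavg s1 alg m Mprev c Mstar (take k outs) (nth Mprev outs k).

Lemma loss_ge0 k : 0 <= loss k.
Proof. by rewrite subr_ge0; apply: bavg_le1. Qed.

Definition small_losses := forall k, (k < H)%N -> 256 * H%:R ^+ 2 * zeta * loss k <= 1.

(** The constant is the 2 of [occ_hell_le] times the [2 * SA] of [bhatt_candidate]. *)
Lemma occ_explorer_hell k s a : (k.+1 < H)%N ->
  occ Mstar s1 (explorer k s a) c k s * pol (explorer k s a) k s a *
    hell Mhat Mstar c k s a <= 4 * SA * loss k.
Proof.
move=> kH.
apply: le_trans (@occ_hell_le _ _ _ _ _ _ s1 (nth Mprev outs k) _ _ _ _ _ _ kH) _.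
have := bhatt_candidate reg0 A0 Mstar (nth Mprev outs k)
  (mem_explorer alg m Mprev c outs k s a).
rewrite -/SA /loss; lra.
Qed.

Lemma explorer_hell k s a : (k.+1 < H)%N ->
  docc_expl k s a <= 2 * occ_expl k s a ->
  docc_expl k s a * hell Mhat Mstar c k s a <= 8 * SA * loss k.
Proof.
move=> kH le2.
apply: le_trans (ler_wpM2r (hell_ge0 _ _ _ _ _ _) le2) _.
have := occ_explorer_hell s a kH; lra.
Qed.

(** Let D be the trusted occupancy of the explorer. Trust gives D P^ >= SA / zeta and
    [explorer_hell] gives D hell <= 8 SA loss. So hell <= 8 zeta loss P^ <= P^ / (32 H^2), which is
    what [sqrt_close_le] asks for with K = H. *)
Lemma trusted_ratio k s a s' : small_losses -> (k.+1 < H)%N ->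
  docc_expl k s a <= 2 * occ_expl k s a ->
  tr k s a s' ->
  trans Mhat k s a c s' * (1 - (2 * H%:R)^-1) <= trans Mstar k s a c s'.
Proof.
move=> gd kH le2.
have ks : (k <= size outs)%N by rewrite sz_outs (ltnW (ltnW kH)).
rewrite (trustedP reg0 argmax_explore A0 _ _ _ ks).
rewrite -/Mhat -/zeta -/SA => tru.
have hk := explorer_hell kH le2.
apply: sqrt_close_le; rewrite ?trans_ge0 //.
have : (Num.sqrt (trans Mhat k s a c s') - Num.sqrt (trans Mstar k s a c s')) ^+ 2
    <= 2 * hell Mhat Mstar c k s a.
  rewrite -sqrt_sub_le_hell (bigD1 s') //= lerDl.
  by apply: sumr_ge0 => t _; exact: sqr_ge0.
have gk := gd k (ltnW kH).
have l0 := loss_ge0 k.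
have p0 := trans_ge0 Mhat k s a c s'.
have D0 : 0 <= docc_expl k s a by rewrite mulr_ge0 ?docc_ge0 ?pol_ge0.
have h0 := hell_ge0 Mhat Mstar c k s a.
move: (docc_expl k s a) D0 hk tru {le2} => D D0 hk tru hsq.
apply: le_trans (ler_wpM2l _ hsq) _; first by rewrite mulr_ge0 // sqr_ge0.
have Dp : 0 < D * trans Mhat k s a c s'.
  by apply: lt_le_trans tru; rewrite mulr_gt0 ?invr_gt0 // (lt_le_trans _ SA1).
have D0' : 0 < D by rewrite lt0r D0 andbT; apply: contraTneq Dp => ->; rewrite mul0r ltxx.
rewrite -(ler_pM2l D0').
have tru' : SA <= zeta * (D * trans Mhat k s a c s') by rewrite -ler_pdivrMl.
have e1 : 32 * H%:R ^+ 2 * (D * hell Mhat Mstar c k s a) <=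
    32 * H%:R ^+ 2 * (8 * SA * loss k).
  by rewrite ler_wpM2l // mulr_ge0 // sqr_ge0.
have e2 : 256 * H%:R ^+ 2 * loss k * SA <=
    256 * H%:R ^+ 2 * loss k * (zeta * (D * trans Mhat k s a c s')).
  by apply: ler_wpM2l tru'; rewrite mulr_ge0 ?l0 ?mulr_ge0 ?ler0n ?sqr_ge0.
have e3 := ler_wpM2r (ltW Dp) gk.
lra.
Qed.

(** Induction on the layer for all policies at once, since comparing the kernels of layer [k]
    requires the bound for the explorers of that layer. Each trusted transition costs one factor 1 -
    1 / (2 H). *)
Lemma docc_occ h pi s : small_losses -> (h < H)%N ->
  docc h c pi s * (1 - (2 * H%:R)^-1) ^+ h <= occ Mstar s1 pi c h s.
Proof.
move=> gd; elim: h pi s => [|k IH] pi s hH; first by rewrite expr0 mulr1.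
have u1 : 0 <= 1 - (2 * H%:R)^-1 :> R.
  by have h1 := HR1; rewrite subr_ge0 invf_le1; lra.
(* The factor accumulated so far is at least 1 / 2. *)
have IH2 p t : docc k c p t <= 2 * occ Mstar s1 p c k t.
  have := IH p t (ltnW hH).
  have := ler_wpM2l (docc_ge0 s1 alg m Mprev c outs k p t)
            (@bernoulli_half R k H H0 (ltnW (ltnW hH))).
  lra.
rewrite /= big_mkcond /= mulr_suml; apply: ler_sum => -[t a] _ /=.
have RHS0 : 0 <= occ Mstar s1 pi c k t * pol pi k t a * trans Mstar k t a c s.
  by rewrite !mulr_ge0 ?occ_ge0 ?pol_ge0 ?trans_ge0.
case: ifP => [tru|_]; last by rewrite mul0r.
have := @trusted_ratio k t a s gd hH _ tru.
rewrite -/Mhat; move=> /(_ _)/wrap[].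
  by rewrite mulrA ler_wpM2r ?pol_ge0.
move=> rat.
have w0 : 0 <= docc k c pi t * (1 - (2 * H%:R)^-1) ^+ k * pol pi k t a.
  by rewrite !mulr_ge0 ?docc_ge0 ?pol_ge0 ?exprn_ge0.
rewrite exprSr.
apply: le_trans (_ : _ <= docc k c pi t * (1 - (2 * H%:R)^-1) ^+ k * pol pi k t a *
  trans Mstar k t a c s) _.
  have := ler_wpM2l w0 rat.
  rewrite /Mhat /=; lra.
by rewrite ler_wpM2r ?trans_ge0 // ler_wpM2r ?pol_ge0 // IH // ltnW.
Qed.

Lemma docc_explorer_occ k s a : small_losses -> (k < H)%N ->
  docc_expl k s a <= 2 * occ_expl k s a.
Proof.
move=> gd kH; rewrite mulrA ler_wpM2r ?pol_ge0 //.
have := docc_occ (explorer k s a) s gd kH.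
have := ler_wpM2l (docc_ge0 s1 alg m Mprev c outs k (explorer k s a) s)
            (@bernoulli_half R k H H0 (ltnW kH)).
lra.
Qed.

Lemma layer_err_le k pi : small_losses -> (k.+1 < H)%N ->
  \sum_(x : S * A) docc k c pi x.1 * pol pi k x.1 x.2 *
     step_err Mhat Mstar c (tr k x.1 x.2) k x.1 x.2 <=
  16 * zeta * loss k + 2 * (#|S|%:R ^+ 3 * #|A|%:R ^+ 2) / zeta.
Proof.
move=> gd kH.
have ks : (k <= size outs)%N by rewrite sz_outs (ltnW (ltnW kH)).
set B := #|S|%:R ^+ 3 * #|A|%:R ^+ 2.
have B0 : 0 < B by rewrite mulr_gt0 // exprn_gt0.
(* This weight balances the errors: the untrusted mass costs SA times S times SA / zeta, that is B /
   zeta, and so does 1 / kap. *)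
pose kap := zeta / B.
have kap0 : 0 < kap by rewrite divr_gt0.
have step x : step_err Mhat Mstar c (tr k x.1 x.2) k x.1 x.2 <=
   \sum_(s' | ~~ tr k x.1 x.2 s') trans Mhat k x.1 x.2 c s' +
   (kap * (2 * hell Mhat Mstar c k x.1 x.2) + kap^-1).
  rewrite /step_err lerD2l.
  rewrite -sqrt_sub_le_hell mulr_sumr -[kap^-1]mul1r -(trans_sum1 Mhat k x.1 x.2 c).
  rewrite mulr_suml -big_split /= big_mkcond; apply: ler_sum => s' _.
  have := @sub_le_sqrt _ _ _ _ (trans_ge0 Mhat k x.1 x.2 c s')
    (trans_ge0 Mstar k x.1 x.2 c s') kap0.
  case: ifP => // _; apply: le_trans.
  by rewrite le_max lexx.
apply: le_trans (_ : _ <= \sum_(x : S * A) (#|S|%:R * (zeta^-1 * SA) +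
     (2 * kap * (8 * SA * loss k) + docc k c pi x.1 * pol pi k x.1 x.2 * kap^-1))) _.
  apply: ler_sum => -[s a] _ /=.
  have w0 : 0 <= docc k c pi s * pol pi k s a by rewrite mulr_ge0 ?docc_ge0 ?pol_ge0.
  apply: le_trans (ler_wpM2l w0 (step (s, a))) _ => /=.
  have wD : docc k c pi s * pol pi k s a <= docc_expl k s a.
    exact: (docc_explorer reg0 argmax_explore A0 _ _ _ ks).
  rewrite mulrDr; apply: lerD; last first.
    rewrite mulrDr lerD2r.
    have := explorer_hell kH (docc_explorer_occ s a gd (ltnW kH)).
    have := ler_wpM2r (hell_ge0 Mhat Mstar c k s a) wD.
    move: (docc_expl k s a) => D h1 h2.
    have := ler_wpM2l (ltW kap0) (le_trans h1 h2); lra.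
  have -> : #|S|%:R * (zeta^-1 * SA) = \sum_(s' : S) zeta^-1 * SA.
    by rewrite big_const iter_addr_0 mulr_natl.
  rewrite mulr_sumr [leLHS]big_mkcond; apply: ler_sum => s' _.
  case: ifPn => [|_]; last by rewrite mulr_ge0 ?invr_ge0 // ltW // (lt_le_trans _ SA1).
  (* An untrusted transition carries less than SA / zeta even under its explorer, hence also under
     [pi]. *)
  rewrite (trustedP reg0 argmax_explore A0 _ _ _ ks) -ltNge.
  move=> /ltW; apply: le_trans; rewrite -/Mhat ler_wpM2r ?trans_ge0 //.
rewrite !big_split /= -[X in _ + (_ + X)]mulr_suml.
have cSA (x : R) : \sum_(i : S * A) x = SA * x.
  by rewrite big_const iter_addr_0 card_prod -[LHS]mulr_natl natrM.
rewrite !cSA.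
have mass : \sum_(x : S * A) docc k c pi x.1 * pol pi k x.1 x.2 <= 1.
  apply: le_trans (docc_mass s1 alg m Mprev c outs pi (ltnW (ltnW kH))).
  rewrite sum_pairE; apply: ler_sum => s _ /=.
  by rewrite -mulr_sumr pol_sum1 ?mulr1 // ltnW.
have ki0 : 0 <= kap^-1 by rewrite invr_ge0 ltW.
have {}mass := ler_wpM2r ki0 mass.
have kv : kap^-1 = B / zeta by rewrite /kap invf_div.
have e1 : SA * (#|S|%:R * (zeta^-1 * SA)) = B / zeta.
  by rewrite /SA /B; field; do ?[apply/andP; split]; exact: lt0r_neq0.
have e2 : SA * (2 * kap * (8 * SA * loss k)) <= 16 * zeta * loss k.
  have l0 := loss_ge0 k.
  have -> : SA * (2 * kap * (8 * SA * loss k)) = 16 * zeta * loss k * #|S|%:R^-1.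
    by rewrite /kap /SA /B; field; do ?[apply/andP; split]; exact: lt0r_neq0.
  by rewrite ler_piMr ?invf_le1 // mulr_ge0 // mulr_ge0 // ltW.
rewrite e1.
rewrite kv in mass *.
lra.
Qed.

Theorem tvdist_pointwise (pi : policy) :
  tvdist s1 Mhat Mstar pi c <=
    256 * H%:R ^+ 2 * zeta * \sum_(k < H) loss k +
    2 * H%:R * (#|S|%:R ^+ 3 * #|A|%:R ^+ 2) / zeta.
Proof.
set B := #|S|%:R ^+ 3 * #|A|%:R ^+ 2.
have B0 : 0 <= B / zeta.
  by apply: divr_ge0; [rewrite mulr_ge0 // exprn_ge0 // ltW|exact: ltW].
have lsum0 : 0 <= \sum_(k < H) loss k by apply: sumr_ge0 => k _; exact: loss_ge0.
have [gd|/existsNP[k /not_implyP[kH /negP]]] := pselect small_losses; last first.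
  rewrite -ltNge => bad.
  (* One loss above the threshold makes the right side exceed 1, which bounds any distance. *)
  apply: le_trans (tvdist_le1 _ _ _ _ _) _.
  apply: le_trans (ltW bad) _; rewrite -[leLHS]addr0 lerD //.
    apply: ler_wpM2l.
      by rewrite mulr_ge0 ?(ltW zeta0) ?mulr_ge0 ?ler0n ?sqr_ge0.
    rewrite (bigD1 (Ordinal kH)) //= lerDl.
    by apply: sumr_ge0 => j _; exact: loss_ge0.
  by rewrite -mulrA mulr_ge0 // mulr_ge0 // ler0n.
apply: le_trans (@tvdist_hybrid _ _ _ _ _ _ s1 Mhat Mstar pi c
  (fun k => tr k) (fun k => docc k c pi) H0 _ _ _) _ => //.
  by move=> h s; exact: docc_ge0.
rewrite big_mkord.
apply: le_trans (_ : _ <= \sum_(k < H.-1) (16 * zeta * loss k + 2 * B / zeta)) _.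
  by apply: ler_sum => k _; apply: layer_err_le => //; rewrite -ltn_predRL ltn_ord.
apply: le_trans (_ : _ <= \sum_(k < H) (16 * zeta * loss k + 2 * B / zeta)) _.
  have [n Hn] : exists n, H = n.+1 by exists H.-1; rewrite prednK.
  rewrite Hn /= [leRHS]big_ord_recr /= lerDl.
  apply: addr_ge0; last by rewrite -mulrA mulr_ge0.
  by rewrite mulr_ge0 ?loss_ge0 // mulr_ge0 // ltW.
rewrite big_split /= -mulr_sumr big_const iter_addr_0 card_ord -[X in _ + X]mulr_natl.
apply: lerD; last by rewrite le_eqVlt; apply/orP; left; apply/eqP; ring.
rewrite ler_wpM2r // ler_wpM2r ?(ltW zeta0) //.
(* Small losses only need the constant 16; 256 H^2 comes from the other case. *)
have : 1 <= H%:R ^+ 2 :> R by rewrite exprn_ege1.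
lra.
Qed.

End PointwiseBound.

(** * Total rewards *)

(** On nonnegative functions the integral is a supremum over the simple functions below, hence
    monotone without measurability. *)
Lemma le_lower_integral d (T : measurableType d) (R : realType)
    (mu : measure T R) (f g : T -> \bar R) :
  (forall x, (0 <= f x)%E) -> (forall x, (f x <= g x)%E) ->
  (\int[mu]_x f x <= \int[mu]_x g x)%E.
Proof.
move=> f0 fg; have g0 x : (0 <= g x)%E by apply: le_trans (f0 x) (fg x).
rewrite !ge0_integralTE //; apply: le_ereal_sup => _ [h hf <-].
by exists h => // x; apply: le_trans (hf x) (fg x).
Qed.

Section Probability.
Variables (R : realType) (d : measure_display) (T : measurableType d).
Variable P : probability T R.

Lemma integral_prob_cst (r : \bar R) : (\int[P]_x cst r x = r)%E.
Proof.
rewrite integral_cst //.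
exact: etrans (congr1 (fun u => (r * u)%E) (@probability_setT _ _ _ P)) (mule1 _).
Qed.

Lemma Rintegral_prob_cst (r : R) : \int[P]_x r = r.
Proof.
rewrite Rintegral_cst //.
exact: etrans (congr1 (fun u => r * fine u) (@probability_setT _ _ _ P)) (mulr1 _).
Qed.

Lemma integrable_bounded (f : T -> R) (B : R) :
  measurable_fun [set: T] f -> (forall r, `|f r| <= B) ->
  P.-integrable [set: T] (EFin \o f).
Proof.
move=> mf fB; apply: measurable_bounded_integrable => //.
  by have := ltry (1 : R); rewrite -[X in (X < _)%E](@probability_setT _ _ _ P); exact.
exists B; split; first exact: num_real.
by move=> M BM r _; apply: le_trans (fB r) (ltW BM).
Qed.

Lemma integral_Rintegral (f : T -> R) : P.-integrable [set: T] (EFin \o f) ->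
  (\int[P]_x (f x)%:E = (\int[P]_x f x)%:E)%E.
Proof. by move=> fi; rewrite /Rintegral fineK //; apply: integrable_fin_num. Qed.

End Probability.

Section Rewards.
Variable R : realType.
Local Notation law := (probability (measurableTypeR R) R).
Implicit Types (mu : law) (mus : seq law).

Definition clip (r : R) : R := Num.max 0 (Num.min 1 r).

Lemma clip_ge0 r : 0 <= clip r.
Proof. by rewrite le_max lexx. Qed.

Lemma clip_le1 r : clip r <= 1.
Proof. by rewrite ge_max ler01 ge_min lexx. Qed.

Lemma clip_id r : 0 <= r <= 1 -> clip r = r.
Proof. by case/andP=> r0 r1; rewrite /clip (min_idPr r1) (max_idPr r0). Qed.

Lemma measurable_clip : measurable_fun [set: measurableTypeR R] clip.
Proof.
apply: measurable_maxr => //.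
by apply: measurable_minr => //; exact: measurable_id.
Qed.

(* The expectation of a law on [0, 1]: the clipped integrand is bounded. *)
Definition mean mu : R := \int[mu]_r clip r.

Definition in01 mu := mu [set` `[0, 1]%R] = 1%E.

Lemma ae_eq_in01 mu (f g : R -> \bar R) : in01 mu ->
  (forall r, 0 <= r <= 1 -> f r = g r) -> ae_eq mu [set: measurableTypeR R] f g.
Proof.
move=> mu01 fg; exists (~` [set` `[0, 1]%R]); split => /=.
- by apply: measurableC; exact: measurable_itv.
- rewrite probability_setC; last exact: measurable_itv.
  by rewrite mu01 subee.
- by move=> r /= nr; apply: contra_not nr; rewrite in_itv /= => r01 _; exact: fg.
Qed.

Lemma integrable_clip mu : mu.-integrable [set: measurableTypeR R] (EFin \o clip).
Proof.
apply: (@integrable_bounded _ _ _ _ _ 1); first exact: measurable_clip.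
by move=> r; rewrite ger0_norm ?clip_ge0 ?clip_le1.
Qed.

Lemma mean_ge0 mu : 0 <= mean mu.
Proof. by apply: Rintegral_ge0 => r _; exact: clip_ge0. Qed.

(** The law charges only [0, 1], where [clip] is the identity, so the integrand may be taken
    bounded. *)
Lemma integral_affine mu a b : in01 mu ->
  (\int[mu]_r (a + b * r)%:E = (a + b * mean mu)%:E)%E.
Proof.
move=> mu01.
have mc := measurable_clip.
have ic := integrable_clip mu.
have m1 : measurable_fun [set: measurableTypeR R] (fun r : R => a + b * clip r).
  by apply: measurable_funD => //; apply: measurable_funM.
have ib : mu.-integrable [set: measurableTypeR R] (EFin \o (fun r => b * clip r)).
  apply: (@integrable_bounded _ _ _ _ _ `|b|); first exact: measurable_funM.
  by move=> r; rewrite normrM ler_piMr // ger0_norm ?clip_ge0 ?clip_le1.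
have ia : mu.-integrable [set: measurableTypeR R] (EFin \o (fun _ : R => a)).
  by apply: (@integrable_bounded _ _ _ _ _ `|a|).
rewrite (@ae_eq_integral _ _ _ mu setT (fun r => (a + b * clip r)%:E)) //; first last.
- by apply: ae_eq_in01 => // r r01; rewrite clip_id.
- exact/measurable_EFinP.
- by apply/measurable_EFinP; apply: measurable_funD.
transitivity ((\int[mu]_r (a + b * clip r))%:E).
  apply: integral_Rintegral.
  apply: (@integrable_bounded _ _ _ _ _ (`|a| + `|b|)) => // r.
  apply: le_trans (ler_normD _ _) _; rewrite lerD2l normrM ler_piMr //.
  by rewrite ger0_norm ?clip_ge0 ?clip_le1.
by rewrite RintegralD // Rintegral_prob_cst RintegralZl.
Qed.

Definition total_mean mus : R := \sum_(mu <- mus) mean mu.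

Lemma total_mean_ge0 mus : 0 <= total_mean mus.
Proof. by apply: sumr_ge0 => mu _; exact: mean_ge0. Qed.

Lemma sum_expect_EFin mus y : (forall mu, List.In mu mus -> in01 mu) ->
  sum_expect mus EFin y = (y + total_mean mus)%:E.
Proof.
rewrite /total_mean; elim: mus y => [|mu mus IH] y h /=; first by rewrite big_nil addr0.
rewrite big_cons.
under eq_integral => r _.
  rewrite IH; last by move=> nu nui; apply: h; right.
  rewrite [X in X%:E](_ : _ = (y + \sum_(j <- mus) mean j) + 1 * r); last by ring.
  over.
rewrite integral_affine; last by apply: h; left.
by congr EFin; ring.
Qed.

Local Notation ind01 := (fun y : R => (\1_([set` `[0, 1]%R] : set R) y)%:E).

Lemma sum_expect_ge0 mus y : (0 <= sum_expect mus ind01 y)%E.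
Proof.
elim: mus y => [|mu mus IH] y /=; first by rewrite lee_fin indicE ler0n.
by apply: integral_ge0 => r _; exact: IH.
Qed.

Lemma sum_expect_le1 mus y : (sum_expect mus ind01 y <= 1)%E.
Proof.
elim: mus y => [|mu mus IH] y /=; first by rewrite lee_fin indicE lern1 leq_b1.
apply: (@le_trans _ _ (\int[mu]_r cst 1%E r)%E).
  by apply: le_lower_integral => r; [exact: sum_expect_ge0|exact: IH].
by rewrite integral_prob_cst.
Qed.

(* A total of mean above 1 exceeds 1 with positive probability.  Only the upper
   bounding function has to be measurable, as the integral is monotone on all
   nonnegative functions. *)
Lemma sum_expect_ind_le mus y B : (forall mu, List.In mu mus -> in01 mu) ->
  0 < B -> 0 <= y -> y + (size mus)%:R <= B ->
  (sum_expect mus ind01 y <= (1 + (1 - (y + total_mean mus)) / B)%:E)%E.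
Proof.
move=> + B0; elim: mus y => [|mu mus IH] y h y0 yB.
  rewrite /total_mean big_nil addr0 lee_fin indicE.
  rewrite addr0 in yB.
  rewrite mem_setE in_itv /= y0 /=; case: (leP y 1) => [y1|y1] /=.
    by rewrite lerDl divr_ge0 ?subr_ge0 // ltW.
  by rewrite -lerBlDl sub0r ler_pdivlMr // mulN1r; lra.
rewrite /= -natr1 in yB.
have h' nu : List.In nu mus -> in01 nu by move=> ?; apply: h; right.
have mu01 : in01 mu by apply: h; left.
(* The induction hypothesis covers [r] in [0, 1]; elsewhere, on a null set, the trivial bound 1
   keeps the majorant valid and measurable. *)
pose G (r : R) : R := if (0 <= r) && (r <= 1) then
   (1 + (1 - (y + total_mean mus)) / B) + (- B^-1) * r else 1.
have GE r : 0 <= r <= 1 -> G r = (1 + (1 - (y + total_mean mus)) / B) + (- B^-1) * r.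
  by rewrite /G => ->.
apply: (@le_trans _ _ (\int[mu]_r (G r)%:E)%E) => /=.
  apply: le_lower_integral => r; first exact: sum_expect_ge0.
  rewrite /G; case: ifPn => [/andP[r0 r1]|_]; last exact: sum_expect_le1.
  apply: le_trans (IH (y + r) h' _ _) _; [by rewrite addr_ge0|by lra|].
  by rewrite lee_fin le_eqVlt; apply/orP; left; apply/eqP; field; lra.
have mG : measurable_fun [set: measurableTypeR R] G.
  apply: measurable_fun_ifT => //.
    by apply: measurable_and; apply: measurable_fun_ler => //; exact: measurable_id.
  by apply: measurable_funD.
rewrite (@ae_eq_integral _ _ _ mu setT (fun r =>
  ((1 + (1 - (y + total_mean mus)) / B) + (- B^-1) * r)%:E)) //; first last.
- by apply: ae_eq_in01 => // r r01; rewrite GE.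
- by apply/measurable_EFinP; apply: measurable_funD.
- exact/measurable_EFinP.
rewrite integral_affine // /total_mean big_cons lee_fin.
by rewrite le_eqVlt; apply/orP; left; apply/eqP; field; lra.
Qed.

Variables (H : nat) (S A : finType) (s1 : S).
Variables (d : measure_display) (ctx : measurableType d).
Local Notation model := (model R S A ctx).
Local Notation policy := (policy R H S A).
Local Notation traj := (traj H S A).
Implicit Types (M : model) (Rw : reward R S A ctx) (pi : policy) (c : ctx).

Definition traj_laws Rw c (x : traj) : seq law :=
  [seq (Rw h (tnth x h).1 (tnth x h).2 c : law) | h : 'I_H].

Lemma traj_laws01 Rw c x mu : List.In mu (traj_laws Rw c x) -> in01 mu.
Proof.
rewrite /traj_laws /image_mem; elim: (enum _) => [//|h l IH] /= [<-|//].
exact: rlaw01.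
Qed.

Lemma valueE M Rw pi c :
  value s1 M Rw pi c =
  \sum_(x : traj) traj_prob s1 M pi c x * total_mean (traj_laws Rw c x).
Proof.
rewrite /value /total_expect.
under eq_bigr => x _.
  rewrite sum_expect_EFin; last exact: traj_laws01.
  rewrite add0r -EFinM; over.
by rewrite sumEFin.
Qed.

(** A trajectory of positive probability whose total reward has mean above 1 would leave [0, 1] with
    positive probability, against [normalized]. *)
Lemma normalized_total_mean M Rw pi c x : normalized H s1 M Rw ->
  0 < traj_prob s1 M pi c x -> total_mean (traj_laws Rw c x) <= 1.
Proof.
move=> nrm px; rewrite leNgt; apply/negP => gt1.
have := nrm pi c; rewrite /total_expect => E.
set m := total_mean _ in gt1.
(* The bound of [sum_expect_ind_le] for y = 0 and B = H + 1. *)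
pose e : R := 1 + (1 - m) / (H%:R + 1).
have H1 : 0 < H%:R + 1 :> R by rewrite ltr_wpDl ?ler0n.
have e1 : e < 1.
  by rewrite /e gtrDl pmulr_llt0 ?invr_gt0 // subr_lt0.
suff : (\sum_(x : traj) (traj_prob s1 M pi c x)%:E *
     sum_expect (traj_laws Rw c x) ind01 0 < 1)%E.
  by rewrite E ltxx.
apply: (@le_lt_trans _ _ (\sum_(z : traj)
  (traj_prob s1 M pi c z * (if z == x then e else 1))%:E)%E).
  apply: lee_sum => z _; rewrite EFinM; apply: lee_wpmul2l.
    by rewrite lee_fin traj_prob_ge0.
  case: eqP => [->|_]; last exact: sum_expect_le1.
  apply: le_trans (sum_expect_ind_le _ H1 _ _) _ => //; first exact: traj_laws01.
    by rewrite add0r size_map -cardE card_ord lerDl.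
  by rewrite add0r.
rewrite sumEFin lte_fin -[ltRHS](traj_prob_sum1 s1 M pi c).
rewrite (bigD1 x) //= [ltRHS](bigD1 x) //=.
rewrite eqxx; apply: ltr_leD; first by rewrite gtr_pMr.
by apply: ler_sum => z /negPf ->; rewrite mulr1.
Qed.

(** Given the trajectory, the mean total reward is the same number under both models, and it lies in
    [0, 1] whenever one of them gives the trajectory positive probability. *)
Lemma value_diff_le M1 M2 Rw pi c :
  normalized H s1 M1 Rw -> normalized H s1 M2 Rw ->
  `|value s1 M1 Rw pi c - value s1 M2 Rw pi c| <= tvdist s1 M2 M1 pi c.
Proof.
move=> n1 n2; rewrite !valueE -sumrB.
(* Both laws have mass 1, so the positive and negative parts of their difference have the same
   sum. *)
have sym : \sum_(x : traj) Num.max 0 (traj_prob s1 M1 pi c x - traj_prob s1 M2 pi c x)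
   = tvdist s1 M2 M1 pi c.
  apply/eqP; rewrite -subr_eq0 /tvdist -sumrB.
  rewrite (eq_bigr (fun x => traj_prob s1 M1 pi c x - traj_prob s1 M2 pi c x)).
    by rewrite sumrB !traj_prob_sum1 subrr.
  move=> x _; move: (traj_prob _ _ _ _ _) (traj_prob _ _ _ _ _) => p q.
  by case: (leP 0 (p - q)) => h1; case: (leP 0 (q - p)) => h2; lra.
have term x :
   - Num.max 0 (traj_prob s1 M2 pi c x - traj_prob s1 M1 pi c x) <=
   traj_prob s1 M1 pi c x * total_mean (traj_laws Rw c x) -
   traj_prob s1 M2 pi c x * total_mean (traj_laws Rw c x) <=
   Num.max 0 (traj_prob s1 M1 pi c x - traj_prob s1 M2 pi c x).
  have := @normalized_total_mean M1 Rw pi c x n1.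
  have := @normalized_total_mean M2 Rw pi c x n2.
  have := traj_prob_ge0 s1 M1 pi c x; have := traj_prob_ge0 s1 M2 pi c x.
  have := total_mean_ge0 (traj_laws Rw c x).
  move: (traj_prob s1 M1 pi c x) (traj_prob s1 M2 pi c x) (total_mean _).
  move=> p q t t0 q0 p0 tq tp.
  have mx (u : R) : u <= Num.max 0 u by rewrite le_max lexx orbT.
  have m0 (u : R) : 0 <= Num.max 0 u by rewrite le_max lexx.
  have M1q := mx (q - p); have M2q := mx (p - q).
  have M3q := m0 (q - p); have M4q := m0 (p - q).
  move: (Num.max 0 (q - p)) (Num.max 0 (p - q)) M1q M2q M3q M4q => b a hb ha b0 a0.
  have [p00|p_gt0] := leP p 0; have [q00|q_gt0] := leP q 0.
  - have -> : p = 0 by lra.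
    have -> : q = 0 by lra.
    by rewrite !mul0r subrr oppr_le0 b0 a0.
  - have {}tq := tq q_gt0; have -> : p = 0 by lra.
    have : q * t <= q by rewrite ler_piMr.
    have : 0 <= q * t by rewrite mulr_ge0.
    lra.
  - have {}tp := tp p_gt0; have -> : q = 0 by lra.
    have : p * t <= p by rewrite ler_piMr.
    have : 0 <= p * t by rewrite mulr_ge0.
    lra.
  have {}tp := tp p_gt0.
  have [pq|pq] := leP p q.
    have h1 : 0 <= (q - p) * (1 - t) by rewrite mulr_ge0 // subr_ge0.
    have h2 : 0 <= (q - p) * t by rewrite mulr_ge0 // subr_ge0.
    lra.
  have h1 : 0 <= (p - q) * (1 - t) by rewrite mulr_ge0 // subr_ge0 // ltW.
  have h2 : 0 <= (p - q) * t by rewrite mulr_ge0 // subr_ge0 // ltW.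
  lra.
rewrite ler_norml; apply/andP; split.
  rewrite /tvdist -sumrN; apply: ler_sum => x _; by have /andP[] := term x.
by rewrite -sym; apply: ler_sum => x _; have /andP[] := term x.
Qed.

Lemma mean_zero mu : mu [set 0] = 1%E -> mean mu = 0.
Proof.
move=> mu0; rewrite /mean /Rintegral.
rewrite (@ae_eq_integral _ _ _ mu setT (cst 0%E)) //; first last.
- exists (~` [set 0]); split => /=.
  + by apply: measurableC.
  + by rewrite probability_setC // mu0 subee.
  + move=> r /= nr r0; apply: nr => _; rewrite r0 clip_id ?lexx ?ler01 //.
- apply/measurable_EFinP; exact: measurable_clip.
by rewrite integral_prob_cst.
Qed.

Lemma own_value0 M pi c : zero_reward H M -> own_value s1 M pi c = 0.
Proof.
move=> z; rewrite /own_value valueE big1 // => x _.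
rewrite /total_mean big_map big1 ?mulr0 // => h _.
by apply: mean_zero; apply: z.
Qed.

Lemma reg_zero M pi c : zero_reward H M -> reg s1 M pi c = 0.
Proof.
move=> z; rewrite /reg own_value0 // subr0.
have -> : range (fun p : policy => own_value s1 M p c) = [set 0].
  apply/seteqP; split => [_ [p _ <-]|_ ->] /=; first exact: own_value0.
  by exists pi => //; exact: own_value0.
by rewrite sup1.
Qed.

Lemma zero_reward_assemble M outs : zero_reward H M ->
  (forall M', List.In M' outs -> zero_reward H M') -> zero_reward H (assemble M outs).
Proof.
move=> z zs h s a c hH /=; apply: (_ : zero_reward H (nth M outs h)) => //.
elim: outs h {hH} zs => [|M' outs IH] [|h] zs //=; first by apply: zs; left.
by apply: IH => N NI; apply: zs; right.
Qed.

End Rewards.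

(** * Expectations over an epoch *)

Section Measurability.
Variables (R : realType) (H : nat) (S A : finType).
Variables (d : measure_display) (ctx : measurableType d).
Local Notation model := (model R S A ctx).
Local Notation policy := (policy R H S A).

Lemma measurable_path_prob (M : model) (p : ctx -> policy) h (mu : ctx -> S -> R) x :
  policy_measurable p -> (forall s, measurable_fun [set: ctx] (mu^~ s)) ->
  measurable_fun [set: ctx] (fun c => path_prob M (p c) c h (mu c) x).
Proof.
move=> mp; elim: x h mu => [|[s a] x IH] h mu mmu //=.
apply: measurable_funM.
  by apply: measurable_funM; [exact: mmu|exact: mp].
by apply: (IH _ (fun c s' => trans M h s a c s')) => s'; exact: trans_meas.
Qed.

Lemma measurable_bhatt s1 (M1 M2 : model) (p : ctx -> policy) :
  policy_measurable p ->
  measurable_fun [set: ctx] (fun c => bhatt s1 M1 M2 (p c) c).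
Proof.
move=> mp; apply: measurable_sum => x.
have msq : measurable_fun [set: R] (@Num.sqrt R).
  by apply: continuous_measurable_fun; exact: sqrt_continuous.
apply: (measurableT_comp msq); apply: measurable_funM.
  by apply: measurable_path_prob => // s; exact: measurable_cst.
by apply: measurable_path_prob => // s; exact: measurable_cst.
Qed.

Lemma measurable_all (T : Type) (l : seq T) (B : T -> ctx -> bool) :
  (forall t, measurable_fun [set: ctx] (B t)) ->
  measurable_fun [set: ctx] (fun c => all (B^~ c) l).
Proof.
by move=> mB; elim: l => [|t l IH] /=; [exact: measurable_cst|exact: measurable_and].
Qed.

(** Reduces equality of policies to finitely many equations between reals, which are measurable
    events. *)
Lemma policy_eqP (p q : policy) :
  reflect (p = q) (all (fun x : 'I_H * S * A =>
     pol p x.1.1 x.1.2 x.2 == pol q x.1.1 x.1.2 x.2) (enum {: 'I_H * S * A})).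
Proof.
apply: (iffP allP) => [eqpq|-> x _ //].
apply: val_inj; apply: eq_from_tnth => h; apply/ffunP => s; apply/ffunP => a.
have := eqpq (h, s, a); rewrite mem_enum => /(_ isT)/eqP /=.
by rewrite /pol !(tnth_nth 0).
Qed.

Lemma measurable_policy_eq (p q : ctx -> policy) :
  policy_measurable p -> policy_measurable q ->
  measurable_fun [set: ctx] (fun c => p c == q c).
Proof.
move=> mp mq.
rewrite (_ : (fun c => _) = (fun c => all (fun x : 'I_H * S * A =>
     pol (p c) x.1.1 x.1.2 x.2 == pol (q c) x.1.1 x.1.2 x.2) (enum {: 'I_H * S * A}))).
  by apply: measurable_all => x; apply: measurable_fun_eqr.
by apply: funext => c; apply/eqP/policy_eqP.
Qed.

(** Which candidates coincide depends on the context. An entry survives [undup] exactly when it does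
    not recur later in the list, a measurable event. *)
Lemma measurable_sum_undup (T : Type) (l : seq T) (p : T -> ctx -> policy)
    (F : policy -> ctx -> R) :
  (forall t, policy_measurable (p t)) ->
  (forall t, measurable_fun [set: ctx] (fun c => F (p t c) c)) ->
  measurable_fun [set: ctx] (fun c => \sum_(q <- undup [seq p t c | t <- l]) F q c).
Proof.
move=> mp mF; elim: l => [|t l IH].
  by under eq_fun do rewrite big_nil; exact: measurable_cst.
pose new c := ~~ (p t c \in [seq p u c | u <- l]).
have -> : (fun c => \sum_(q <- undup [seq p u c | u <- t :: l]) F q c) =
  (fun c => (if new c then F (p t c) c else 0) +
     \sum_(q <- undup [seq p u c | u <- l]) F q c).
  apply: funext => c /=; rewrite /new; case: ifP => //= _; last by rewrite big_cons.
  by rewrite add0r.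
apply: measurable_funD => //; apply: measurable_fun_ifT => //.
have -> : new = (fun c => all (fun u => ~~ (p t c == p u c)) l).
  apply: funext => c; rewrite /new; elim: (l) => //= u l' IHl.
  by rewrite inE negb_or IHl.
by apply: measurable_all => u; apply: measurable_neg; apply: measurable_policy_eq.
Qed.

Lemma measurable_natinv (K : ctx -> nat) (N : nat) : (forall c, (K c <= N)%N) ->
  measurable_fun [set: ctx] (fun c => (K c)%:R : R) ->
  measurable_fun [set: ctx] (fun c => (K c)%:R^-1 : R).
Proof.
move=> KN mK.
have -> : (fun c => (K c)%:R^-1 : R) =
   (fun c => \sum_(k < N.+1) if (K c)%:R == k%:R :> R then k%:R^-1 else 0).
  apply: funext => c.
  rewrite (bigD1 (Ordinal (KN c : (K c < N.+1)%N))) //= eqxx big1 ?addr0 // => k kK.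
  by rewrite eqr_nat ifF //; apply: contraNF kK => /eqP Kk; apply/eqP/val_inj.
apply: measurable_sum => k; apply: measurable_fun_ifT => //.
by apply: measurable_fun_eqr.
Qed.
End Measurability.

(** * Lower bounds for the expectation operators of one epoch *)

Section Epoch.
Variables (R : realType) (H : nat) (S A : finType) (s1 : S).
Variables (d : measure_display) (ctx : measurableType d).
Local Notation model := (model R S A ctx).
Local Notation policy := (policy R H S A).
Local Notation traj := (traj H S A).
Local Notation datum := (datum R H S A ctx).
Variables (alg : inputs R H S A ctx) (m : nat) (Mprev : model).
Variables (D : probability ctx R) (I : finType) (Mcls : I -> model) (istar : I).
Local Notation Mstar := (Mcls istar).
Hypothesis A0 : (0 < #|A|)%N.
Hypothesis reg0 : forall (pi : policy) c, reg s1 Mprev pi c = 0.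
Hypothesis meas_greedy : policy_measurable (lo_greedy alg Mprev).
Hypothesis meas_explore : forall outs s a,
  policy_measurable (lo_explore alg m Mprev outs s a).
Hypothesis mle : is_MLE s1 Mcls (lo_oracle alg).

Local Notation cands outs c := (candidates alg m Mprev outs c).
Local Notation play outs c pi := (play_prob s1 alg m Mprev outs c pi).
Local Notation avg outs M c := (bavg s1 alg m Mprev c Mstar outs M).

Lemma measurable_bavg outs M : measurable_fun [set: ctx] (fun c => avg outs M c).
Proof.
(* [None] stands for the greedy policy, so that all candidates form one indexed family. *)
pose T := option (S * A).
pose p (t : T) := if t is Some x then lo_explore alg m Mprev outs x.1 x.2
  else lo_greedy alg Mprev.
pose l : seq T := None :: [seq Some x | x <- enum {: S * A}].
have candE c : cands outs c = undup [seq p t c | t <- l].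
  by rewrite /candidates /= -map_comp.
have mp t : policy_measurable (p t) by case: t => [x|] /=.
have -> : (fun c => avg outs M c) = (fun c =>
   (size (cands outs c))%:R^-1 *
   \sum_(pi <- undup [seq p t c | t <- l]) bhatt s1 M Mstar pi c).
  apply: funext => c; rewrite /bavg mulr_sumr -candE; apply: eq_bigr => pi _.
  by rewrite play_probE.
apply: measurable_funM; last first.
  apply: (measurable_sum_undup l (F := fun pi c => bhatt s1 M Mstar pi c)) => // t.
  exact: measurable_bhatt.
apply: (@measurable_natinv _ _ _ _ (size l)) => [c|].
  by rewrite candE (leq_trans (size_undup _)) // size_map.
have -> : (fun c => (size (cands outs c))%:R : R) =
  (fun c => \sum_(pi <- undup [seq p t c | t <- l]) 1).
  by apply: funext => c; rewrite candE big_const_seq count_predT iter_addr_0.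
exact: (measurable_sum_undup l (F := fun=> fun=> 1)).
Qed.

Definition bmean outs M : R := \int[D]_c avg outs M c.

Lemma integrable_bavg outs M :
  D.-integrable [set: ctx] (EFin \o (fun c => avg outs M c)).
Proof.
apply: (@integrable_bounded _ _ _ _ _ 1); first exact: measurable_bavg.
by move=> c; rewrite ger0_norm ?bavg_ge0 ?bavg_le1.
Qed.

Lemma bmean_ge0 outs M : 0 <= bmean outs M.
Proof. by apply: Rintegral_ge0 => c _; exact: bavg_ge0. Qed.

(** Mean over contexts and played policies of the squared Hellinger distance to [Mstar]. *)
Definition hloss outs M : R := 1 - bmean outs M.

Lemma integral_loss outs M : (\int[D]_c (1 - avg outs M c)%:E = (hloss outs M)%:E)%E.
Proof.
have i1 : D.-integrable [set: ctx] (EFin \o (fun=> 1 : R)).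
  by apply: (@integrable_bounded _ _ _ _ _ 1) => // c; rewrite normr1.
have ib := integrable_bavg outs M.
transitivity ((\int[D]_c (1 - avg outs M c))%:E).
  by apply: integral_Rintegral; exact: (integrableB _ i1 ib).
by rewrite RintegralB // Rintegral_prob_cst.
Qed.

Lemma play_traj_sum1 outs c :
  \sum_(pi <- cands outs c) \sum_(x : traj)
    play outs c pi * traj_prob s1 Mstar pi c x = 1.
Proof.
under eq_bigr do rewrite -mulr_sumr traj_prob_sum1 mulr1.
exact: play_prob_sum1.
Qed.

(** The root is taken because its mean under [Mstar] is a Bhattacharyya coefficient; a zero
    denominator gives the value 0. *)
Definition lratio i (z : datum) : R :=
  Num.sqrt (traj_prob s1 (Mcls i) z.1.2 z.1.1 z.2 / traj_prob s1 Mstar z.1.2 z.1.1 z.2).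

Lemma lratio_ge0 i z : 0 <= lratio i z. Proof. exact: sqrtr_ge0. Qed.

Lemma lratio_mean i pi c x : traj_prob s1 Mstar pi c x * lratio i (c, pi, x) =
  Num.sqrt (traj_prob s1 (Mcls i) pi c x * traj_prob s1 Mstar pi c x).
Proof.
rewrite /lratio /=.
have := traj_prob_ge0 s1 Mstar pi c x; have := traj_prob_ge0 s1 (Mcls i) pi c x.
move: (traj_prob _ _ _ _ _) (traj_prob _ _ _ _ _) => q p p0 q0.
rewrite -{1}(ger0_norm q0) -sqrtr_sqr -sqrtrM ?sqr_ge0 //; congr Num.sqrt.
have [->|qn0] := eqVneq q 0; first by rewrite invr0 !mulr0.
by field.
Qed.

Lemma bavgE outs i c : avg outs (Mcls i) c =
  \sum_(pi <- cands outs c) \sum_(x : traj)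
    play outs c pi * traj_prob s1 Mstar pi c x * lratio i (c, pi, x).
Proof.
rewrite /bavg; apply: eq_bigr => pi _; rewrite mulr_sumr; apply: eq_bigr => x _.
by rewrite -mulrA lratio_mean.
Qed.

Local Notation round outs := (round_expect s1 alg D Mstar m Mprev outs).
Local Notation rounds outs := (rounds_expect s1 alg D Mstar m Mprev outs).

Lemma round_expect_ge0 outs f : (forall z, (0 <= f z)%E) -> (0 <= round outs f)%E.
Proof.
move=> f0; apply: integral_ge0 => c _; apply: sume_ge0 => pi _; apply: sume_ge0 => x _.
by rewrite mule_ge0 // lee_fin mulr_ge0 ?play_prob_ge0 ?traj_prob_ge0.
Qed.

Lemma rounds_expect_ge0 outs n f : (forall xs, (0 <= f xs)%E) -> (0 <= rounds outs n f)%E.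
Proof.
elim: n f => [|n IH] f f0 //=.
by apply: round_expect_ge0 => z; apply: IH.
Qed.

(** A bound affine in the ratios stays affine after averaging over one round, each ratio being
    replaced by its mean [bmean]. Since [f] may fail to be measurable, only this minorant is
    integrated exactly. *)
Lemma round_expect_lower outs f a (b : I -> R) : (forall z, (0 <= f z)%E) ->
  (forall z, 0 < traj_prob s1 Mstar z.1.2 z.1.1 z.2 ->
     ((a - \sum_i b i * lratio i z)%:E <= f z)%E) ->
  ((a - \sum_i b i * bmean outs (Mcls i))%:E <= round outs f)%E.
Proof.
move=> f0 flow.
pose g c := a - \sum_i b i * avg outs (Mcls i) c.
have ibs : D.-integrable [set: ctx] (EFin \o (fun c => \sum_i b i * avg outs (Mcls i) c)).
  rewrite (_ : _ \o _ = (fun c => \sum_i (b i * avg outs (Mcls i) c)%:E)%E).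
    apply: integrable_sum => // i _.
    have -> : (fun c => (b i * avg outs (Mcls i) c)%:E) =
       (fun c => (b i)%:E * (EFin \o (fun c => avg outs (Mcls i) c)) c)%E.
      by apply: funext => c; rewrite EFinM.
    by apply: integrableZl => //; exact: integrable_bavg.
  by apply: funext => c; rewrite /= sumEFin.
have ia : D.-integrable [set: ctx] (EFin \o (fun=> a)).
  by apply: (@integrable_bounded _ _ _ _ _ `|a|).
have ig : D.-integrable [set: ctx] (EFin \o g) by exact: (integrableB _ ia ibs).
have gE : (\int[D]_c (g c)%:E = (a - \sum_i b i * bmean outs (Mcls i))%:E)%E.
  transitivity ((\int[D]_c g c)%:E).
    exact: integral_Rintegral.
  rewrite /g RintegralB // Rintegral_prob_cst.
  congr (_ - _)%:E.
  rewrite /Rintegral; under eq_integral do rewrite -sumEFin.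
  rewrite integral_sum //; last first.
    move=> i; have -> : (fun c => (b i * avg outs (Mcls i) c)%:E) =
       (fun c => (b i)%:E * (EFin \o (fun c => avg outs (Mcls i) c)) c)%E.
      by apply: funext => c; rewrite EFinM.
    by apply: integrableZl => //; exact: integrable_bavg.
  have ib i := integrable_bavg outs (Mcls i).
  transitivity (fine (\sum_i (b i * bmean outs (Mcls i))%:E)%E).
    congr fine; apply: eq_bigr => i _.
    transitivity (\int[D]_c ((b i)%:E * (avg outs (Mcls i) c)%:E))%E.
      by apply: eq_integral => c _; rewrite EFinM.
    rewrite [RHS]EFinM integralZl //; last exact: ib.
    congr (_ * _)%E.
    exact: integral_Rintegral.
  by rewrite sumEFin.
rewrite -gE.
have mg : measurable_fun [set: ctx] g by exact/measurable_EFinP/(measurable_int D).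
(* Monotonicity without measurability needs a nonnegative minorant, hence the positive part of
   [g]. *)
apply: (@le_trans _ _ (\int[D]_c (Num.max 0 (g c))%:E)%E).
  apply: le_integral => //.
    apply: (le_integrable _ _ _ ig) => //.
      by apply/measurable_EFinP; apply: measurable_maxr.
    move=> c _; rewrite lee_fin ger0_norm ?le_max ?lexx // ge_max normr_ge0 /=.
    exact: ler_norm.
  by move=> c _; rewrite lee_fin le_max lexx orbT.
apply: le_lower_integral => c; first by rewrite lee_fin le_max lexx.
have pt0 pi x : 0 <= play outs c pi * traj_prob s1 Mstar pi c x.
  by rewrite mulr_ge0 ?play_prob_ge0 ?traj_prob_ge0.
suff glow : ((g c)%:E <= \sum_(pi <- cands outs c) \sum_(x : traj)
     (play outs c pi * traj_prob s1 Mstar pi c x)%:E * f (c, pi, x))%E.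
  case: (leP 0 (g c)) => // _.
  apply: sume_ge0 => pi _; apply: sume_ge0 => x _.
  by rewrite mule_ge0 // lee_fin pt0.
apply: (@le_trans _ _ (\sum_(pi <- cands outs c) \sum_(x : traj)
   (play outs c pi * traj_prob s1 Mstar pi c x *
     (a - \sum_i b i * lratio i (c, pi, x)))%:E)%E); last first.
  apply: lee_sum => pi _; apply: lee_sum => x _.
  (* Trajectories impossible under [Mstar] have weight 0. *)
  have [p0|pn0] := eqVneq (traj_prob s1 Mstar pi c x) 0.
    by rewrite p0 mulr0 mul0r mul0e.
  rewrite EFinM lee_wpmul2l ?lee_fin ?pt0 // flow //=.
  by rewrite lt0r pn0 traj_prob_ge0.
under eq_bigr do rewrite sumEFin.
rewrite sumEFin lee_fin /g le_eqVlt; apply/orP; left; apply/eqP.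
under [RHS]eq_bigr => pi _.
  under eq_bigr do rewrite mulrBr.
  rewrite sumrB; over.
rewrite sumrB; congr (_ - _).
  under eq_bigr do rewrite -mulr_suml.
  by rewrite -mulr_suml play_traj_sum1 mul1r.
under [LHS]eq_bigr => i _.
  rewrite bavgE mulr_sumr.
  under eq_bigr do rewrite mulr_sumr.
  over.
rewrite exchange_big; apply: eq_bigr => pi _.
rewrite exchange_big; apply: eq_bigr => x _.
by rewrite mulr_sumr; apply: eq_bigr => i _; rewrite mulrCA.
Qed.

(** The rounds of a segment are independent, so the product of the ratios has mean [bmean ^+ n]; in
    the induction the ratio of the first round is absorbed into [b]. *)
Lemma rounds_expect_lower outs n f a (b : I -> R) : (forall xs, (0 <= f xs)%E) ->
  (forall xs, (forall z, List.In z xs -> 0 < traj_prob s1 Mstar z.1.2 z.1.1 z.2) ->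
     ((a - \sum_i b i * \prod_(z <- xs) lratio i z)%:E <= f xs)%E) ->
  ((a - \sum_i b i * bmean outs (Mcls i) ^+ n)%:E <= rounds outs n f)%E.
Proof.
elim: n f a b => [|n IH] f a b f0 flow /=.
  apply: le_trans (flow [::] _); last by [].
  by under [X in (_ <= (_ - X)%:E)%E]eq_bigr do rewrite big_nil.
under eq_bigr do rewrite exprSr mulrA.
apply: round_expect_lower => z.
  by apply: rounds_expect_ge0.
move=> pz; under eq_bigr do rewrite mulrAC.
apply: IH => [xs|xs pxs]; first exact: f0.
apply: le_trans (flow (z :: xs) _); last by move=> y /= [<-|]; [|exact: pxs].
by under [X in (_ <= (_ - X)%:E)%E]eq_bigr do rewrite big_cons mulrA.
Qed.

Lemma rounds_expect_cst outs n f (v : R) : 0 <= v -> (forall xs, f xs = v%:E) ->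
  rounds outs n f = v%:E.
Proof.
move=> v0; elim: n f => [|n IH] f fv /=; first exact: fv.
rewrite /round_expect (eq_integral (cst v%:E)) => [|c _].
  exact: integral_prob_cst.
rewrite -[RHS]mul1e -[in RHS](play_traj_sum1 outs c).
under eq_bigr do under eq_bigr do rewrite IH // -EFinM.
under eq_bigr do rewrite sumEFin.
rewrite sumEFin /= -EFinM mulr_suml; congr EFin; apply: eq_bigr => pi _.
by rewrite mulr_suml.
Qed.

Local Notation segments := (segments_expect s1 alg D Mstar m Mprev).

Definition is_outs outs := exists js, outs = [seq Mcls j | j <- js].

Lemma is_outs_rcons outs xs : is_outs outs -> is_outs (rcons outs (lo_oracle alg xs)).
Proof.
move=> [js ->]; have [i [-> _]] := mle xs.
by exists (rcons js i); rewrite map_rcons.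
Qed.

Lemma segments_expect_ge0 k outs calls F : is_outs outs ->
  (forall outs' cs, is_outs outs' -> (0 <= F (assemble Mprev outs') cs)%E) ->
  (0 <= segments k outs calls F)%E.
Proof.
move=> + F0; elim: k outs calls => [|k IH] outs calls io /=; first exact: F0.
by apply: rounds_expect_ge0 => xs; apply: IH; exact: is_outs_rcons.
Qed.

Lemma segments_expect_cst k outs calls F (v : R) : 0 <= v -> is_outs outs ->
  (forall outs' cs, is_outs outs' -> size outs' = (size outs + k)%N ->
    size cs = (size calls + k)%N -> F (assemble Mprev outs') cs = v%:E) ->
  segments k outs calls F = v%:E.
Proof.
move=> v0; elim: k outs calls => [|k IH] outs calls io Fv /=.
  by apply: Fv; rewrite ?addn0.
apply: rounds_expect_cst => // xs; apply: IH; first exact: is_outs_rcons.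
by move=> outs' cs io' so sc; apply: Fv => //; move: so sc; rewrite !size_rcons; lia.
Qed.

(** Serves for the first epoch: whatever models of the class it outputs, the second epoch obeys the
    same probability bound. *)
Lemma segments_expect_lower_cst k outs calls F (v : R) : is_outs outs ->
  (forall outs' cs, is_outs outs' -> (0 <= F (assemble Mprev outs') cs)%E) ->
  (forall outs' cs, is_outs outs' -> size outs' = (size outs + k)%N ->
    (v%:E <= F (assemble Mprev outs') cs)%E) ->
  (v%:E <= segments k outs calls F)%E.
Proof.
move=> + F0; elim: k outs calls => [|k IH] outs calls io Fv /=.
  by apply: Fv; rewrite ?addn0.
have z0 (G : I -> R) : \sum_i 0 * G i = 0 by rewrite big1 // => i _; rewrite mul0r.
apply: le_trans (@rounds_expect_lower outs _ _ v (fun=> 0) _ _) => [|xs|xs _].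
- by rewrite z0 subr0.
- by apply: segments_expect_ge0 => //; exact: is_outs_rcons.
rewrite z0 subr0; apply: IH; first exact: is_outs_rcons.
by move=> outs' cs io' so; apply: Fv => //; rewrite so size_rcons; lia.
Qed.

(** On data of positive probability the likelihood of [Mstar] is positive, so the product is the
    root of a likelihood ratio. It is applied to the model returned by the oracle. *)
Lemma prod_lratio_ge1 i xs :
  (forall z, List.In z xs -> 0 < traj_prob s1 Mstar z.1.2 z.1.1 z.2) ->
  likelihood s1 Mstar xs <= likelihood s1 (Mcls i) xs ->
  1 <= \prod_(z <- xs) lratio i z.
Proof.
move=> pxs.
have [Ls0 ->] : 0 < likelihood s1 Mstar xs /\ \prod_(z <- xs) lratio i z =
  Num.sqrt (likelihood s1 (Mcls i) xs / likelihood s1 Mstar xs).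
  rewrite /likelihood; elim: xs pxs => [|z xs IH] pxs.
    by rewrite !big_nil divr1 sqrtr1.
  have [L0 E] : _ /\ _ := IH (fun y yxs => pxs y (or_intror yxs)).
  have z0 := pxs z (or_introl erefl).
  rewrite !big_cons E -sqrtrM; last by rewrite divr_ge0 ?traj_prob_ge0 ?(ltW z0).
  split; first by rewrite mulr_gt0.
  by congr Num.sqrt; field; rewrite !lt0r_neq0.
move=> Lle; rewrite -[leLHS]sqrtr1; apply: ler_wsqrtr.
by rewrite ler_pdivlMr // mul1r.
Qed.

Definition total_loss outs : R :=
  \sum_(h < size outs) hloss (take h outs) (nth Mprev outs h).

Lemma total_loss_rcons outs M :
  total_loss (rcons outs M) = total_loss outs + hloss outs M.
Proof.
rewrite /total_loss size_rcons big_ord_recr /=.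
rewrite nth_rcons ltnn eqxx -cats1 take_size_cat; last by [].
congr (_ + _).
apply: eq_bigr => h _.
by rewrite take_cat nth_cat ltn_ord.
Qed.

Let n := (lo_tau alg m - lo_tau alg m.-1)%N.

(* Instead of a union bound over the segments, the likelihood ratios of all the
   segments are multiplied: this controls the sum of the losses at level delta
   without an extra factor log H. *)
Lemma segments_expect_lower k outs calls F (K : R) : 0 <= K -> is_outs outs ->
  (forall outs' cs, is_outs outs' -> (0 <= F (assemble Mprev outs') cs)%E) ->
  (forall outs' cs, is_outs outs' -> size outs' = (size outs + k)%N ->
    ((1 - K * expR (n%:R * total_loss outs'))%:E <= F (assemble Mprev outs') cs)%E) ->
  ((1 - K * #|I|%:R ^+ k * expR (n%:R * total_loss outs))%:E
     <= segments k outs calls F)%E.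
Proof.
move=> K0 + F0; elim: k outs calls => [|k IH] outs calls io Fv /=.
  by rewrite expr0 mulr1; apply: Fv; rewrite ?addn0.
(* The failure bound for the remaining segments if the oracle returns model [i]. *)
pose b i := K * #|I|%:R ^+ k * expR (n%:R * total_loss (rcons outs (Mcls i))).
have b0 i : 0 <= b i by rewrite !mulr_ge0 ?exprn_ge0 ?expR_ge0.
apply: (@le_trans _ _ (1 - \sum_i b i * bmean outs (Mcls i) ^+ n)%:E).
  rewrite lee_fin lerD2l lerN2 exprSr.
  rewrite [leRHS](_ : _ =
    \sum_(i : I) K * #|I|%:R ^+ k * expR (n%:R * total_loss outs)); last first.
    by rewrite big_const iter_addr_0 -[RHS]mulr_natl; ring.
  (* As [bmean] is 1 - hloss <= exp (- hloss), its [n]-th power compensates the growth of the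
     exponential caused by the new loss. *)
  apply: ler_sum => i _; rewrite /b total_loss_rcons mulrDr expRD -!mulrA.
  rewrite !ler_wpM2l ?exprn_ge0 // ler_piMr ?expR_ge0 //.
  rewrite expRM_natl -exprMn exprn_ile1 ?mulr_ge0 ?expR_ge0 ?bmean_ge0 //.
  have -> : bmean outs (Mcls i) = 1 + - hloss outs (Mcls i) by rewrite /hloss; ring.
  apply: le_trans (ler_wpM2l (expR_ge0 _) (expR_ge1Dx _)) _.
  by rewrite -expRD subrr expR0.
apply: rounds_expect_lower => [xs|xs pxs].
  by apply: segments_expect_ge0 => //; exact: is_outs_rcons.
have [i [oi imax]] := mle xs.
have pl := prod_lratio_ge1 pxs (imax istar).
have ior := is_outs_rcons xs io.
apply: le_trans (IH _ _ ior _); last first.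
  by move=> outs' cs io' so; apply: Fv => //; rewrite so size_rcons; lia.
(* The sum contains the term of the returned model, whose product of ratios is at least 1. *)
rewrite oi lee_fin lerD2l lerN2 -/(b i) (bigD1 i) //=.
rewrite -[leLHS]mulr1 -[leLHS]addr0; apply: lerD; first by rewrite ler_wpM2l.
by apply: sumr_ge0 => j _; rewrite mulr_ge0 // prodr_ge0 // => z _; exact: lratio_ge0.
Qed.

End Epoch.

(** * Probability bound for the two epochs *)

Section Lolipop.
Variables (R : realType) (H : nat) (S A : finType) (s1 : S).
Variables (d : measure_display) (ctx : measurableType d).
Local Notation model := (model R S A ctx).
Local Notation policy := (policy R H S A).
Variables (alg : inputs R H S A ctx) (D : probability ctx R).
Variables (I : finType) (Mcls : I -> model) (istar : I).
Local Notation Mstar := (Mcls istar).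
Hypothesis A0 : (0 < #|A|)%N.
Hypothesis H0 : (0 < H)%N.
Hypothesis mle : is_MLE s1 Mcls (lo_oracle alg).
Hypothesis valid : valid_choices s1 alg.
Hypothesis zero_cls : forall i, zero_reward H (Mcls i).

Lemma zero_reward_outs Mprev outs : zero_reward H Mprev -> is_outs Mcls outs ->
  zero_reward H (assemble Mprev outs).
Proof.
move=> z [js ->]; apply: zero_reward_assemble => // M'.
by elim: js => //= j js IH [<-|/IH]; [exact: zero_cls|].
Qed.

Lemma integral_value_diff m Mprev outs Rw (pi : ctx -> policy) :
  zero_reward H Mprev -> size outs = H -> 0 < zeta_m alg m ->
  normalized H s1 Mstar Rw -> normalized H s1 (assemble Mprev outs) Rw ->
  (\int[D]_c (`|value s1 Mstar Rw (pi c) c -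
                value s1 (assemble Mprev outs) Rw (pi c) c|)%:E <=
   (256 * H%:R ^+ 2 * zeta_m alg m * total_loss s1 alg m Mprev D Mcls istar outs +
    2 * H%:R * (#|S|%:R ^+ 3 * #|A|%:R ^+ 2) / zeta_m alg m)%:E)%E.
Proof.
move=> z sz zeta0 n1 n2.
have [_ _ vg ve] := valid.
have reg0 (p : policy) c : reg s1 Mprev p c = 0 by apply: reg_zero.
have mg : policy_measurable (lo_greedy alg Mprev) by case: (vg Mprev).
have me outs' s a : policy_measurable (lo_explore alg m Mprev outs' s a).
  by case: (ve m Mprev outs' s a).
set C1 := 256 * _ * _; set C2 := _ / zeta_m alg m.
have C10 : 0 <= C1 by rewrite mulr_ge0 ?(ltW zeta0) // mulr_ge0 // exprn_ge0.
have C20 : 0 <= C2 by rewrite divr_ge0 ?(ltW zeta0) // !mulr_ge0 ?exprn_ge0.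
pose l k c := loss s1 alg m Mprev c Mstar outs k.
have l0 k c : 0 <= l k c by apply: loss_ge0.
have ml k : measurable_fun [set: ctx] (fun c => (C1 * l k c)%:E).
  apply/measurable_EFinP; apply: measurable_funM => //; apply: measurable_funB => //.
  exact: measurable_bavg.
(* The left integrand need not be measurable in the context; it is dominated by a measurable
   function. *)
apply: (@le_trans _ _ (\int[D]_c (\sum_(k < H) (C1 * l k c)%:E + C2%:E))%E).
  apply: le_lower_integral => c; first by rewrite lee_fin normr_ge0.
  rewrite sumEFin -EFinD lee_fin -mulr_sumr.
  apply: le_trans (value_diff_le (pi c) c n1 n2) _.
  apply: tvdist_pointwise => // outs' s a.
  by case: (ve m Mprev outs' s a) => _; exact.
rewrite ge0_integralD //; first last.
- by apply: emeasurable_sum => k; exact: ml.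
- by move=> c _; apply: sume_ge0 => k _; rewrite lee_fin mulr_ge0.
rewrite (@integral_prob_cst _ _ _ D C2%:E).
rewrite ge0_integral_sum //; last by move=> k c _; rewrite lee_fin mulr_ge0.
rewrite EFinD leeD2r // /total_loss mulr_sumr sz -sumEFin.
apply: lee_sum => k _.
rewrite (eq_integral (fun c => (C1%:E * (l k c)%:E)%E)); last by move=> c _; rewrite EFinM.
rewrite ge0_integralZl //; last first.
- by move=> c _; rewrite lee_fin.
- apply/measurable_EFinP; apply: measurable_funB => //; exact: measurable_bavg.
have il : (\int[D]_c (l k c)%:E =
    (hloss s1 alg m Mprev D Mcls istar (take k outs) (nth Mprev outs k))%:E)%E.
  exact: (integral_loss D Mcls istar A0 reg0 mg me).
by rewrite il -EFinM.
Qed.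

Hypothesis two : lo_N alg = 2%N.

(** A Markov-type argument with K = delta / |I|^H, for which the failure bound at the start of the
    second epoch is exactly [delta]. Where the losses exceed the threshold, K exp (t) is at least
    delta / delta^H >= 1 and the lower bound on the indicator is trivial. *)
Lemma lolipop_prob_lower (E : set (model * seq (seq (datum R H S A ctx)))) (delta : R) :
  0 < delta -> delta < 1 ->
  (forall Mprev outs cs, zero_reward H Mprev -> is_outs Mcls outs -> size outs = H ->
     (lo_tau alg 2 - lo_tau alg 1)%:R * total_loss s1 alg 2 Mprev D Mcls istar outs <=
       H%:R * ln (#|I|%:R / delta) ->
     E (assemble Mprev outs, cs)) ->
  ((1 - delta)%:E <= lolipop_prob s1 alg D Mstar E)%E.
Proof.
move=> d0 d1 good.
have [_ z0 vg ve] := valid.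
have I1 : 1 <= #|I|%:R :> R by rewrite ler1n; apply/card_gt0P; exists istar.
have I0 : 0 < #|I|%:R :> R by apply: lt_le_trans I1.
have nil_outs : is_outs Mcls [::] by exists [::].
have F0 M cs : (0 <= (\1_E (M, cs))%:E :> \bar R)%E by rewrite lee_fin indicE ler0n.
rewrite /lolipop_prob two.
have reg1 (p : policy) c : reg s1 (lo_M0 alg) p c = 0 by apply: reg_zero.
have g1 : policy_measurable (lo_greedy alg (lo_M0 alg)) by case: (vg (lo_M0 alg)).
have e1 outs s a : policy_measurable (lo_explore alg 1 (lo_M0 alg) outs s a).
  by case: (ve 1%N (lo_M0 alg) outs s a).
apply: (segments_expect_lower_cst D istar A0 reg1 g1 e1 mle) => //.
  move=> outs1 cs1 io1; have z1 := zero_reward_outs z0 io1.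
  move: (assemble _ outs1) z1 => M1 z1.
  have reg2 (p : policy) c : reg s1 M1 p c = 0 by apply: reg_zero.
  exact: (@segments_expect_ge0 _ _ _ _ _ _ _ _ _ _ D _ _ istar A0 reg2 mle H
    [::] cs1 _ nil_outs).
move=> outs1 cs1 io1 sz1.
have z1 := zero_reward_outs z0 io1.
move: (assemble _ outs1) z1 => M1 z1.
have reg2 (p : policy) c : reg s1 M1 p c = 0 by apply: reg_zero.
have g2 : policy_measurable (lo_greedy alg M1) by case: (vg M1).
have e2 outs s a : policy_measurable (lo_explore alg 2 M1 outs s a).
  by case: (ve 2%N M1 outs s a).
have K0 : 0 <= delta / #|I|%:R ^+ H by rewrite divr_ge0 ?exprn_ge0 // ltW.
have := @segments_expect_lower _ _ _ _ _ _ _ _ _ _ D _ _ istar A0 reg2 g2 e2 mle H [::] cs1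
  (fun M calls => (\1_E (M, calls))%:E) _ K0 nil_outs (fun outs cs _ => F0 _ cs).
rewrite [total_loss _ _ _ _ _ _ _ [::]]/total_loss big_ord0 mulr0 expR0 mulr1.
rewrite divfK; last first.
  by rewrite expf_neq0 // lt0r_neq0.
apply => outs cs io; rewrite add0n => sz.
set t := _ * total_loss _ _ _ _ _ _ _ _.
have [tH|tH] := leP t (H%:R * ln (#|I|%:R / delta)).
  rewrite indicE mem_set; last exact: good.
  by rewrite lee_fin gerBl mulr_ge0 ?expR_ge0.
apply: le_trans (F0 _ _); rewrite lee_fin subr_le0.
have Id0 : 0 < #|I|%:R / delta by rewrite divr_gt0.
have : expR (H%:R * ln (#|I|%:R / delta)) <= expR t by rewrite ler_expR ltW.
rewrite expRM_natl lnK ?posrE // => h.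
apply: le_trans (ler_wpM2l K0 h).
rewrite expr_div_n -mulrA [leRHS](_ : _ = delta / delta ^+ H); last first.
  by field; rewrite !expf_neq0 ?lt0r_neq0.
rewrite ler_pdivlMr ?exprn_gt0 // mul1r.
have [k ->] : exists k, H = k.+1 by exists H.-1; lia.
by rewrite exprS ler_piMr ?(ltW d0) // exprn_ile1 ?(ltW d0) // ltW.
Qed.

Lemma lolipop_calls (E : set (model * seq (seq (datum R H S A ctx)))) :
  (forall M cs, size cs = (2 * H)%N -> E (M, cs)) ->
  lolipop_prob s1 alg D Mstar E = 1%E.
Proof.
move=> EH; have [_ z0 _ _] := valid.
have nil_outs : is_outs Mcls [::] by exists [::].
rewrite /lolipop_prob two.
have reg1 (p : policy) c : reg s1 (lo_M0 alg) p c = 0 by apply: reg_zero.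
apply: (segments_expect_cst 1 D istar A0 reg1 mle) => // outs1 cs1 io1 sz1 szc1.
have z1 := zero_reward_outs z0 io1.
move: (assemble _ outs1) z1 => M1 z1.
have reg2 (p : policy) c : reg s1 M1 p c = 0 by apply: reg_zero.
apply: (segments_expect_cst 2 D istar A0 reg2 mle) => // outs2 cs2 io2 sz2 szc2.
by rewrite indicE mem_set //; apply: EH; rewrite szc2 szc1 add0n mul2n addnn.
Qed.

End Lolipop.

(** * Tuning *)

Section Tuning.
Variable R : realType.

(* With W = H^6 S^4 A^3, both error terms are at most a constant times
   sqrt (W E), where E is the error of the oracle. *)
Lemma tuned_error (C0 E h s a e g z : R) (B := 256 / C0 + 64 * e) :
  0 < C0 -> 0 < E -> 1 <= h -> 1 <= s -> 1 <= a -> 1 <= e ->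
  g = Num.sqrt (h ^+ 6 * s ^+ 4 * a ^+ 3 / E) ->
  z = g / (8 * e * h * (h + 1) ^+ 2) ->
  0 < z /\
  256 * h ^+ 2 * z * (h * (E / C0)) + 2 * h * (s ^+ 3 * a ^+ 2) / z <=
    B * Num.sqrt (h ^+ 6 * s ^+ 4 * a ^+ 3 * E).
Proof.
move=> C00 E0 h1 s1 a1 e1 gE zE.
have h0 : 0 < h by apply: lt_le_trans h1.
have s0 : 0 < s by apply: lt_le_trans s1.
have a0 : 0 < a by apply: lt_le_trans a1.
have e0 : 0 < e by apply: lt_le_trans e1.
have hn := ltW h0; have sn := ltW s0; have an := ltW a0; have en := ltW e0.
set W := h ^+ 6 * s ^+ 4 * a ^+ 3 in gE *.
have W0 : 0 < W by rewrite !mulr_gt0 ?exprn_gt0.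
have g0 : 0 < g by rewrite gE sqrtr_gt0 divr_gt0.
(* Both sides are expressed through [g], using W = g^2 E. *)
have YE : Num.sqrt (W * E) = g * E.
  have -> : W * E = W / E * E ^+ 2 by field; rewrite lt0r_neq0.
  rewrite sqrtrM; last by rewrite divr_ge0 // ltW.
  by rewrite -gE sqrtr_sqr gtr0_norm.
have WE : W = g ^+ 2 * E.
  rewrite gE sqr_sqrtr; last by rewrite divr_ge0 // ltW.
  by field; rewrite lt0r_neq0.
have d0 : 0 < 8 * e * h * (h + 1) ^+ 2 by rewrite !mulr_gt0 ?exprn_gt0 // addr_gt0.
have z0 : 0 < z by rewrite zE divr_gt0.
split=> //; rewrite YE /B [leRHS]mulrDl; apply: lerD.
  have zle : h ^+ 3 * z <= g.
    rewrite zE mulrCA ler_piMr ?(ltW g0) // ler_pdivrMr // mul1r.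
    have : 0 <= (e - 1) * h * (h + 1) ^+ 2.
      by rewrite !mulr_ge0 ?exprn_ge0 // ?subr_ge0 // addr_ge0.
    have : 0 <= h * (h + 1) ^+ 2 - h ^+ 3.
      have -> : h * (h + 1) ^+ 2 - h ^+ 3 = 2 * h ^+ 2 + h by ring.
      by rewrite addr_ge0 ?mulr_ge0 ?sqr_ge0.
    have : 0 <= h ^+ 3 by rewrite exprn_ge0.
    lra.
  rewrite [leLHS](_ : _ = 256 / C0 * E * (h ^+ 3 * z)); last first.
    by field; rewrite lt0r_neq0.
  rewrite [leRHS](_ : _ = 256 / C0 * E * g); last by ring.
  by apply: ler_wpM2l zle; rewrite mulr_ge0 ?divr_ge0 ?ler0n ?(ltW C00) ?(ltW E0).
(* The constant 64 is 2 times the 8 in [z], times 4 from (h + 1)^2 <= 4 h^2. *)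
have -> : 2 * h * (s ^+ 3 * a ^+ 2) / z =
    16 * e * h ^+ 2 * (h + 1) ^+ 2 * (s ^+ 3 * a ^+ 2) / g.
  rewrite zE; field; rewrite !lt0r_neq0 //; lra.
rewrite ler_pdivrMr //.
have -> : 64 * e * (g * E) * g = 64 * e * W by rewrite WE; ring.
have k1 : (h + 1) ^+ 2 <= 4 * h ^+ 2.
  have : 0 <= (h - 1) * (3 * h + 1) by rewrite mulr_ge0 ?subr_ge0 //; lra.
  nra.
have k2 : s ^+ 3 * a ^+ 2 <= s ^+ 4 * a ^+ 3.
  by apply: ler_pM; rewrite ?exprn_ge0 ?(ltW s0) ?(ltW a0) // ler_weXn2l.
have k3 : h ^+ 4 <= h ^+ 6 by rewrite ler_weXn2l.
apply: (@le_trans _ _ (16 * e * h ^+ 2 * (4 * h ^+ 2) * (s ^+ 4 * a ^+ 3))).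
  apply: ler_pM => //.
  - by rewrite !mulr_ge0 ?exprn_ge0 ?addr_ge0.
  - by rewrite mulr_ge0 ?exprn_ge0.
  - by rewrite ler_wpM2l // !mulr_ge0 ?exprn_ge0.
have -> : 16 * e * h ^+ 2 * (4 * h ^+ 2) * (s ^+ 4 * a ^+ 3) =
   64 * e * (s ^+ 4 * a ^+ 3) * h ^+ 4 by ring.
have -> : 64 * e * W = 64 * e * (s ^+ 4 * a ^+ 3) * h ^+ 6 by rewrite /W; ring.
by rewrite ler_wpM2l // !mulr_ge0 ?exprn_ge0.
Qed.

(** The 8 is [2 * N ^+ 2] for two epochs, by which the algorithm divides [delta]; for [x >= 2] it
    costs a constant factor, as 8 = 2^3. *)
Lemma ln_scale_bounds (x : R) : 2 <= x ->
  0 < ln x /\ ln x <= ln (8 * x) <= 4 * ln x.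
Proof.
move=> x2; have x0 : 0 < x by lra.
have l2 : 0 < ln (2 : R) by rewrite ln_gt0 //; lra.
have l2x : ln 2 <= ln x by rewrite ler_ln ?posrE.
have -> : ln (8 * x) = ln 2 + (ln 2 + (ln 2 + ln x)).
  rewrite -!lnM ?posrE ?mulr_gt0 //; congr ln; ring.
by split; [lra|apply/andP; split; lra].
Qed.

(** Of the 16, one factor 4 is that of [4 * l]; the other is that of [4 * eps ^+ 2 * n], the price
    of two epochs and of rounding [n] down. *)
Lemma sample_size (C C0 B W l eps n : R) : 0 < C0 -> 0 < B -> 0 < W -> 0 < l ->
  0 < eps -> 0 < n ->
  16 * C0 * B ^+ 2 <= C -> C * W * l <= 4 * eps ^+ 2 * n ->
  B * Num.sqrt (W * (C0 * (4 * l) / n)) <= eps.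
Proof.
move=> C00 B0 W0 l0 eps0 n0 BC Cn.
have eB0 : 0 <= eps / B by rewrite divr_ge0 ?(ltW B0) ?(ltW eps0).
rewrite mulrC -ler_pdivlMr // -[leRHS]ger0_norm // -sqrtr_sqr.
apply: ler_wsqrtr.
rewrite [leLHS](_ : _ = 4 * C0 * W * l / n); last by field; rewrite lt0r_neq0.
rewrite ler_pdivrMr // expr_div_n [leRHS]mulrAC ler_pdivlMr ?exprn_gt0 //.
have : 16 * C0 * B ^+ 2 * (W * l) <= C * (W * l) by rewrite ler_wpM2r // mulr_ge0 // ltW.
lra.
Qed.

End Tuning.

(** [T] is a positive multiple of [2 * H] so that the segments have whole lengths, hence the maximum
    with the least such number. It depends neither on the law of the contexts nor on the true
    model. *)
Theorem theorem6p1 (R : realType) (C0 : R) (hC0 : 0 < C0) :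
  exists C C' : R, 0 < C /\ 0 < C' /\
  forall (H : nat) (S A : finType) (s1 : S)
    (d : measure_display) (ctx : measurableType d)
    (I : finType) (Mcls : I -> model R S A ctx) (eps delta : R),
  (0 < H)%N -> (0 < #|A|)%N ->
  (forall i, zero_reward H (Mcls i)) ->
  0 < eps -> 0 < delta -> delta < 1 / 2 ->
  exists T : nat,
    (0 < T)%N /\ (2 * H %| T)%N /\
    T%:R <= Num.max (2 * H)%:R
      (C * (H%:R ^+ 7 * #|S|%:R ^+ 4 * #|A|%:R ^+ 3
            * ln (#|I|%:R / delta)) / eps ^+ 2) /\
    forall (D : probability ctx R) (istar : I)
      (mle : seq (datum R H S A ctx) -> model R S A ctx)
      (E1 : R) (M0 : model R S A ctx)
      (greedy : model R S A ctx -> ctx -> policy R H S A)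
      (explore : nat -> model R S A ctx -> seq (model R S A ctx) ->
                 S -> A -> ctx -> policy R H S A),
    let alg := {| lo_N := 2; lo_tau := two_epochs H T; lo_delta := delta;
                  lo_err := MLE_err I C0; lo_oracle := mle; lo_E1 := E1;
                  lo_M0 := M0; lo_greedy := greedy;
                  lo_explore := explore |} in
    is_MLE s1 Mcls mle -> valid_choices s1 alg ->
    ((1 - delta)%:E <=
       lolipop_prob s1 alg D (Mcls istar)
         [set Mc | forall (Rw : reward R S A ctx) (pi : ctx -> policy R H S A),
            normalized H s1 (Mcls istar) Rw -> normalized H s1 Mc.1 Rw ->
            (\int[D]_c (`|value s1 (Mcls istar) Rw (pi c) c
                          - value s1 Mc.1 Rw (pi c) c|)%:E <= eps%:E)%E])%E
    /\ lolipop_prob s1 alg D (Mcls istar)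
         [set Mc | (size Mc.2)%:R <= C' * H%:R] = 1%E.
Proof.
pose e : R := expR 1.
have e1 : 1 <= e by rewrite /e -[leLHS]expR0 ler_expR.
pose B : R := 256 / C0 + 64 * e.
have epos : 0 < e by apply: lt_le_trans e1.
have B0 : 0 < B by rewrite addr_gt0 ?divr_gt0 ?mulr_gt0 ?ltr0n.
pose C : R := 16 * C0 * B ^+ 2 + 4.
have C4 : 4 <= C by rewrite lerDr !mulr_ge0 ?exprn_ge0 // ltW.
exists C, 2; split; first by apply: lt_le_trans C4.
split=> // H S A s1 d ctx I Mcls eps delta H0 A0 zcls eps0 delta0 deltah.
set X := H%:R ^+ 7 * _ * _ * _.
(* Rounds per segment: one if [eps >= 1], otherwise the bound on [T] divided by the [2 * H]
   segments, rounded down but at least 1. *)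
pose n := if 1 <= eps then 1%N else maxn 1 (Num.trunc (C * X / eps ^+ 2 / (2 * H)%:R)).
have n0 : (0 < n)%N by rewrite /n; case: ifP => // _; rewrite leq_max.
have H1 : 1 <= H%:R :> R by rewrite ler1n.
exists (2 * H * n)%N; split; first by rewrite !muln_gt0 H0.
split; first exact: dvdn_mulr.
split.
  rewrite le_max /n; case: ifP => _; first by rewrite muln1 lexx.
  have [tr0|tr0] := leqP (Num.trunc (C * X / eps ^+ 2 / (2 * H)%:R)) 1.
    by rewrite muln1 lexx.
  apply/orP; right; rewrite natrM mulrC -ler_pdivlMr ?ltr0n ?muln_gt0 //.
  rewrite truncn_le leNgt; apply/negP => /ltW/le_truncn; rewrite truncn0.
  by rewrite leqNgt (ltn_trans _ tr0).
move=> D istar mle E1 M0 greedy explore alg hmle valid.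
have I1 : 1 <= #|I|%:R :> R by rewrite ler1n; apply/card_gt0P; exists istar.
have S1 : 1 <= #|S|%:R :> R by rewrite ler1n; apply/card_gt0P; exists s1.
have A1 : 1 <= #|A|%:R :> R by rewrite ler1n.
have [tau1 tau2] : two_epochs H (2 * H * n) 1 = n /\ two_epochs H (2 * H * n) 2 = (2 * n)%N.
  by rewrite /two_epochs /= mulKn ?muln_gt0 // -mulnA mulnCA mulKn.
split; last first.
  apply: (@lolipop_calls _ _ _ _ _ _ _ alg D _ _ istar A0 hmle valid zcls erefl).
  by move=> M cs /= ->; rewrite natrM.
apply: (@lolipop_prob_lower _ _ _ _ _ _ _ alg D _ _ istar A0 H0 hmle valid zcls erefl)
  => //.
  lra.
move=> Mprev outs cs z io sz loss_le Rw pi /= n1 n2.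
have [eps1|eps1] := leP 1 eps.
  (* Values differ by at most 1, which settles [eps >= 1]. *)
  apply: (@le_trans _ _ (\int[D]_c cst 1%:E c)%E).
    apply: le_lower_integral => c; first by rewrite lee_fin normr_ge0.
    rewrite lee_fin.
    exact: le_trans (value_diff_le (pi c) c n1 n2) (tvdist_le1 _ _ _ _ _).
  by rewrite integral_prob_cst lee_fin.
set l := ln _ in loss_le.
have Id2 : 2 <= #|I|%:R / delta by rewrite ler_pdivlMr //; lra.
have [l0 /andP[l8 l8']] := ln_scale_bounds Id2.
rewrite -/l in l0 l8 l8'.
set L8 := ln (8 * _) in l8 l8'.
have L80 : 0 < L8 by apply: lt_le_trans l8.
have n0R : 0 < n%:R :> R by rewrite ltr0n.
pose E := C0 * L8 / n%:R.
have E0 : 0 < E by rewrite divr_gt0 // mulr_gt0.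
(* Epoch 2 is tuned with the length of the segments of epoch 1, which is [n] as well. *)
have err : err_m alg 2 = E.
  rewrite /err_m /= /MLE_err tau1 subn0 /E /L8; congr (_ * ln _ / _).
  by field; rewrite lt0r_neq0.
have [z0 bnd] := @tuned_error R C0 E H%:R #|S|%:R #|A|%:R e (gamma_m alg 2) (zeta_m alg 2)
   hC0 E0 H1 S1 A1 e1 (congr1 (fun u => Num.sqrt (_ / u)) err) erefl.
apply: le_trans (@integral_value_diff _ _ _ _ _ _ _ alg D _ _ istar A0 H0 valid 2
  Mprev outs Rw pi z sz z0 n1 n2) _.
rewrite lee_fin.
have tl : total_loss s1 alg 2 Mprev D Mcls istar outs <= H%:R * (E / C0).
  move: loss_le; rewrite /= tau1 tau2 mul2n -addnn addnK => tl.
  have -> : E / C0 = L8 / n%:R by rewrite /E; field; rewrite !lt0r_neq0.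
  rewrite mulrA ler_pdivlMr // mulrC; apply: le_trans tl _.
  by rewrite ler_wpM2l.
apply: (@le_trans _ _ (B * Num.sqrt (H%:R ^+ 6 * #|S|%:R ^+ 4 * #|A|%:R ^+ 3 * E))).
  apply: le_trans bnd; rewrite lerD2r; apply: ler_wpM2l tl.
  by rewrite mulr_ge0 ?(ltW z0) ?mulr_ge0 ?exprn_ge0 ?ler0n.
set W := H%:R ^+ 6 * _ * _.
have W0 : 0 < W by rewrite !mulr_gt0 ?exprn_gt0 // (lt_le_trans ltr01).
apply: (@le_trans _ _ (B * Num.sqrt (W * (C0 * (4 * l) / n%:R)))).
  rewrite ler_wpM2l ?(ltW B0) //; apply: ler_wsqrtr; rewrite ler_wpM2l ?(ltW W0) //.
  by rewrite /E ler_wpM2r ?invr_ge0 ?(ltW n0R) // ler_wpM2l // ltW.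
apply: (@sample_size R C C0 B W l eps n%:R) => //; first by rewrite /C lerDl.
have XE : X = W * H%:R * l by rewrite /X /W -/l; ring.
pose q := C * X / eps ^+ 2 / (2 * H)%:R.
(* Rounding down loses at most a factor 2, as [n >= 1]. *)
have q_lt : q < 2 * n%:R.
  have : q < (Num.trunc q).+1%:R by apply: truncnS_gt.
  rewrite -natr1 => /lt_le_trans; apply.
  have : (Num.trunc q)%:R <= n%:R :> R.
    by rewrite ler_nat /n leNgt eps1 /= leq_maxr.
  have : 1 <= n%:R :> R by rewrite ler1n.
  lra.
have -> : C * W * l = q * (2 * eps ^+ 2).
  by rewrite /q XE natrM; field; rewrite !lt0r_neq0 // (lt_le_trans _ H1).
have e20 : 0 < 2 * eps ^+ 2 by rewrite mulr_gt0 ?exprn_gt0.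
have := ler_wpM2r (ltW e20) (ltW q_lt); lra.
Qed.
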